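(* Suppose that Assumption 1 and Assumption 2 hold, and let $\alpha\in(0,1]$ be as in Assumption 2. Let $\theta_0\in\mathbb{R}^d$, $\beta\in(0,1)$ and let $n:\mathbb{N}\to\mathbb{N}$ be such that $\lim_{B\to\infty}n(B)/B=0$ and $\lim_{B\to\infty}n(B)=\infty$. For every $B\in\mathbb{N}$ let $$(\tilde\theta_B,\tilde B)=\mathrm{GD}\big(\theta_0,n(B),B,0,\beta\big),\qquad r(B)=\max\Big(\sqrt{n(B)/B},\,n(B)^{-\frac{\alpha}{1+\alpha}}\Big),$$ with the procedure $\mathrm{GD}$ defined in the context. Then $\|\tilde\theta_B-\theta_\star\|=O_{\mathbb{P}}\big(r(B)\big)$ as $B\to\infty$, and $\liminf_{B\to\infty}B^{\frac{\alpha}{1+3\alpha}}\,r(B)>0$.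
   Context: Setting. $\mathbb{N}=\{1,2,\dots\}$, $d\ge1$. All random variables are defined on a complete probability space $(\Omega,\mathcal{F},\mathbb{P})$. $Z$ is a random variable with values in a Polish space $\mathsf{Z}$, and $(Z_i)_{i\ge1}$ are i.i.d. copies of $Z$. The function $f:\mathbb{R}^d\times\mathsf{Z}\to\mathbb{R}$ is measurable and differentiable in its first argument; $\nabla^k f(\theta,z)$ denotes the $k$-th derivative in $\theta$ ($\nabla^0f=f$). $F(\theta)=\mathbb{E}[f(\theta,Z)]$ is finite for all $\theta$, strictly convex on $\mathbb{R}^d$, and has a (unique) minimizer $\theta_\star=\arg\min_{\theta\in\mathbb{R}^d}F(\theta)$. For $n\in\mathbb{N}$, $F_n(\theta)=\frac1n\sum_{i=1}^n f(\theta,Z_i)$. $\|\cdot\|$ is the Euclidean norm for vectors and the induced operator norm for matrices. No convexity of $\theta\mapsto f(\theta,Z)$ is assumed. Assumption 1. For every compact set $\Theta\subset\mathbb{R}^d$ there is a constant $c_\Theta>0$ such that $F(a\theta_1+(1-a)\theta_2)\le aF(\theta_1)+(1-a)F(\theta_2)-\frac{c_\Theta}{2}a(1-a)\|\theta_1-\theta_2\|^2$ for all $a\in[0,1]$ and $(\theta_1,\theta_2)\in\Theta^2$. Assumption 2. The map $\theta\mapsto f(\theta,z)$ is twice continuously differentiable on $\mathbb{R}^d$ for all $z\in\mathsf{Z}$; $\mathbb{E}[\|\nabla^2 f(\theta_\star,Z)\|]<\infty$ and $\mathbb{E}[\|\nabla f(\theta_\star,Z)\|^{1+\alpha}]<\infty$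 for some $\alpha\in(0,1]$; and for every compact $\Theta\subset\mathbb{R}^d$ there is a measurable $M_\Theta:\mathsf{Z}\to[0,\infty)$ with $\mathbb{E}[M_\Theta(Z)]<\infty$ such that, $\mathbb{P}$-a.s., $\|\nabla^2 f(\theta,Z)-\nabla^2 f(\theta',Z)\|\le M_\Theta(Z)\|\theta-\theta'\|$ for all $(\theta,\theta')\in\Theta^2$. For real random variables $X_B$ and $a_B>0$, $X_B=O_{\mathbb{P}}(a_B)$ means that for every $\epsilon\in(0,1)$ there is a finite $M_\epsilon$ with $\limsup_{B\to\infty}\mathbb{P}(|X_B/a_B|\ge M_\epsilon)\le\epsilon$. Costs. $C_{\mathrm{grad}},C_{\mathrm{eval}}\in\mathbb{N}$ are fixed constants: the costs of computing $\nabla f(\theta,z)$, respectively $f(\theta,z)$, at one pair $(\theta,z)$. Procedure $\mathrm{GD}(\theta_0,n,B,\tau,\beta)$ (gradient descent with backtracking line search), with $\theta_0\in\mathbb{R}^d$, sample size $n$, budget $B$, tolerance $\tau\ge0$, $\beta\in(0,1)$: 1. Set $t=0$, $\theta_{B,0}=\theta_0$, $\tilde B=B$. 2. If $\tilde B\ge nC_{\mathrm{grad}}$: set $G_0=\nabla F_n(\theta_{B,0})$ and $\tilde B\leftarrow\tilde B-nC_{\mathrm{grad}}$. Then, if $\tilde B\ge nC_{\mathrm{eval}}$: set $g_0=F_n(\theta_{B,0})$ and $\tilde B\leftarrow\tilde B-nC_{\mathrm{eval}}$. 3. While $\|G_t\|>\tau$ and $\tilde B\ge nC_{\mathrm{eval}}$: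 (a) set $g_t'=F_n(\theta_{B,t}-G_t)$, $v_{t+1}=1$, $\tilde B\leftarrow\tilde B-nC_{\mathrm{eval}}$; (b) while $g_t'>g_t-\frac{v_{t+1}}2\|G_t\|^2$ and $\tilde B\ge nC_{\mathrm{eval}}$: $v_{t+1}\leftarrow\beta v_{t+1}$, $g_t'\leftarrow F_n(\theta_{B,t}-v_{t+1}G_t)$, $\tilde B\leftarrow\tilde B-nC_{\mathrm{eval}}$; (c) if $g_t'\le g_t-\frac{v_{t+1}}2\|G_t\|^2$: set $\theta_{B,t+1}=\theta_{B,t}-v_{t+1}G_t$, $g_{t+1}=g_t'$, $t\leftarrow t+1$; then, if $\tilde B\ge nC_{\mathrm{grad}}$, set $G_t=\nabla F_n(\theta_{B,t})$ and $\tilde B\leftarrow\tilde B-nC_{\mathrm{grad}}$, otherwise leave the loop of step 3. 4. Return $(\theta_{B,t},\max(\tilde B,0))$. If $G_0$ was not computed in step 2, the loop of step 3 is not entered. *)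

(* Defs.v *)
From HB Require Import structures.
From mathcomp Require Import all_boot all_order all_algebra finmap.
From mathcomp Require Import all_classical all_reals all_analysis.

Set Implicit Arguments.
Unset Strict Implicit.
Unset Printing Implicit Defensive.

Import Order.TTheory GRing.Theory Num.Theory.
Import numFieldNormedType.Exports.

Local Open Scope classical_set_scope.
Local Open Scope ring_scope.

(** Points of R^d are row vectors 'rV[R]_d.  The library norm on matrices is the
    sup norm: it gives the usual topology, but the Euclidean norm and the operator
    norm it induces have to be defined. *)

Definition enorm (R : realType) (d : nat) (u : 'rV[R]_d) : R :=
  Num.sqrt (\sum_(i < d) u ord0 i ^+ 2).

(** Matrices act on row vectors from the right, as 'J does. *)
Definition opnorm (R : realType) (d : nat) (A : 'M[R]_d) : R :=
  sup [set enorm (u *m A) | u in [set u : 'rV[R]_d | enorm u <= 1]].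

Definition gradient (R : realType) (d : nat) (g : 'rV[R]_d -> R) (x : 'rV[R]_d) :
    'rV[R]_d :=
  \row_(i < d) 'D_(delta_mx ord0 i) g x.

Definition hessian (R : realType) (d : nat) (g : 'rV[R]_d -> R) (x : 'rV[R]_d) :
    'M[R]_d :=
  jacobian (gradient g) x.

Definition twice_continuously_differentiable (R : realType) (d : nat)
    (g : 'rV[R]_d -> R) : Prop :=
  [/\ forall x, differentiable g x,
      forall x, differentiable (gradient g) x
    & continuous (hessian g)].

Definition strictly_convex (R : realType) (d : nat) (F : 'rV[R]_d -> R) : Prop :=
  forall (a : R) (x y : 'rV[R]_d), 0 < a -> a < 1 -> x != y ->
    F (a *: x + (1 - a) *: y) < a * F x + (1 - a) * F y.

Definition locally_strongly_convex (R : realType) (d : nat) (F : 'rV[R]_d -> R) :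
    Prop :=
  forall K : set 'rV[R]_d, compact K ->
    exists2 c : R, 0 < c &
      forall (a : R) (x y : 'rV[R]_d), 0 <= a <= 1 -> K x -> K y ->
        F (a *: x + (1 - a) *: y) <=
          a * F x + (1 - a) * F y - c / 2 * a * (1 - a) * enorm (x - y) ^+ 2.

Notation borel T := (g_sigma_algebraType (@open T)).

Definition polish (R : realType) (T : topologicalType) : Prop :=
  (exists2 D : set T, countable D & dense D) /\
  exists dist : T -> T -> R,
    [/\ forall x y, dist x y = 0 <-> x = y,
        forall x y, dist x y = dist y x,
        forall x y z, dist x z <= dist x y + dist y z,
        forall (x : T) (A : set T),
          nbhs x A <-> exists2 e : R, 0 < e & [set y | dist x y < e] `<=` A
      & forall u : nat -> T,
          (forall e : R, 0 < e -> exists N : nat, forall k l : nat,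
              (N <= k)%N -> (N <= l)%N -> dist (u k) (u l) < e) ->
          exists x : T, u @ \oo --> x].

Section Probability.
Context {R : realType} {dO : measure_display} {Omega : measurableType dO}.
Variable P : probability Omega R.

(** [Zs i] stands for the (i+1)-st variable of a sequence numbered from 1. *)
Definition iid_copies (T : ptopologicalType) (Z : Omega -> borel T)
    (Zs : nat -> Omega -> borel T) : Prop :=
  [/\ forall i, measurable_fun setT (Zs i),
      forall i (A : set (borel T)), measurable A -> P (Zs i @^-1` A) = P (Z @^-1` A)
    & forall (J : {fset nat}) (A : nat -> set (borel T)),
        (forall i, measurable (A i)) ->
        P (\bigcap_(i in [set` J]) Zs i @^-1` A i) =
          (\prod_(i <- J) P (Zs i @^-1` A i))%E].

Definition bigO_P (X : nat -> Omega -> R) (a : nat -> R) : Prop :=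
  forall e : R, 0 < e < 1 -> exists M : R,
    (limn_esup (fun B => P [set w | (M <= `|X B w / a B|)%R]) <= e%:E)%E.

Definition risk (d : nat) (T : Type) (f : 'rV[R]_d -> T -> R) (Z : Omega -> T)
    (x : 'rV[R]_d) : R :=
  fine 'E_P[fun w => f x (Z w)]%E.

End Probability.

Definition empirical_risk (R : realType) (d : nat) (T : Type)
    (f : 'rV[R]_d -> T -> R) (zs : nat -> T) (n : nat) (x : 'rV[R]_d) : R :=
  (\sum_(i < n) f x (zs i)) / n%:R.

(** A while loop run for at most [k] iterations.  Every loop below consumes budget
    in each iteration, so a bound equal to the available budget is never the
    reason why it stops; see [while_exit] and [GD_loop_exit]. *)
Fixpoint while (S : Type) (k : nat) (test : S -> bool) (body : S -> S) (s : S) : S :=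
  if k is k'.+1 then if test s then while k' test body (body s) else s else s.

Lemma while_exit (S : Type) (m : S -> nat) (test : S -> bool) (body : S -> S)
    (k : nat) (s : S) :
  (forall t, test t -> (m (body t) < m t)%N) -> (m s <= k)%N ->
  test (while k test body s) = false.
Proof.
move=> dec; elim: k s => [|k IH] s /= ms.
  by apply/negP => /dec; move: ms; rewrite leqn0 => /eqP ->.
case: ifPn => [ts|/negbTE //]; apply: IH.
by rewrite -ltnS (leq_trans (dec _ ts)).
Qed.

Section GradientDescent.
Context {R : realType} {d : nat}.

(** [costg] and [coste] are the costs of one evaluation of the gradient of [Fn],
    resp. of [Fn]. *)
Variables (Fn : 'rV[R]_d -> R) (costg coste : nat) (tau beta : R).

(** The loop state holds theta_t, G_t, g_t and the remaining budget.  [gd_grad] is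
    [None] when G_t could not be paid for, which is the case in which the main loop
    is left (or not entered).  The budget is a natural number: every subtraction is
    guarded by a comparison, so none is truncated. *)
Record gd_state := GDState {
  gd_point : 'rV[R]_d;
  gd_grad : option 'rV[R]_d;
  gd_value : R;
  gd_budget : nat }.

(** If g_0 cannot be paid for, the value 0 stored instead is never read, since
    the test of the main loop then fails. *)
Definition gd_init (x0 : 'rV[R]_d) (B : nat) : gd_state :=
  if (costg <= B)%N then
    let B1 := (B - costg)%N in
    if (coste <= B1)%N then
      GDState x0 (Some (gradient Fn x0)) (Fn x0) (B1 - coste)
    else GDState x0 (Some (gradient Fn x0)) 0 B1
  else GDState x0 None 0 B.

Definition ls_test (g : R) (G : 'rV[R]_d) (s : R * R * nat) : bool :=
  let: (v, g', B) := s in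
  (g - v / 2 * enorm G ^+ 2 < g') && (coste <= B)%N.

Definition ls_body (x G : 'rV[R]_d) (s : R * R * nat) : R * R * nat :=
  let: (v, g', B) := s in
  (beta * v, Fn (x - (beta * v) *: G), (B - coste)%N).

Definition line_search (x G : 'rV[R]_d) (g : R) (B : nat) : R * R * nat :=
  let B1 := (B - coste)%N in
  while B1 (ls_test g G) (ls_body x G) (1, Fn (x - G), B1).

Definition gd_test (s : gd_state) : bool :=
  if gd_grad s is Some G then (tau < enorm G) && (coste <= gd_budget s)%N else false.

Definition gd_body (s : gd_state) : gd_state :=
  if gd_grad s is Some G then
    let x := gd_point s in
    let g := gd_value s in
    let: (v, g', B) := line_search x G g (gd_budget s) in
    if g' <= g - v / 2 * enorm G ^+ 2 then
      let x' := x - v *: G in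
      if (costg <= B)%N then GDState x' (Some (gradient Fn x')) g' (B - costg)
      else GDState x' None g' B
    else GDState x (Some G) g B
  else s.

Definition gd_run (x0 : 'rV[R]_d) (B : nat) : gd_state :=
  while B gd_test gd_body (gd_init x0 B).

Lemma line_search_exit (x G : 'rV[R]_d) (g : R) (B : nat) : (0 < coste)%N ->
  ls_test g G (line_search x G g B) = false.
Proof.
move=> c0; apply: (@while_exit _ snd) => // -[[v g'] B'] /= /andP[_ cB].
by rewrite ltn_subrL c0 (leq_trans c0).
Qed.

Lemma line_search_budget (x G : 'rV[R]_d) (g : R) (B : nat) :
  ((line_search x G g B).2 <= B - coste)%N.
Proof.
rewrite /line_search; set B1 := (B - coste)%N; set s := (X in while _ _ _ X).
suff H k t : ((while k (ls_test g G) (ls_body x G) t).2 <= t.2)%N by exact: (H _ s).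
elim: k t => // k IH t /=; case: ifP => // _; apply: (leq_trans (IH _)).
by case: t => -[v g'] b /=; rewrite leq_subr.
Qed.

Lemma GD_loop_exit (x0 : 'rV[R]_d) (B : nat) : (0 < coste)%N ->
  gd_test (gd_run x0 B) = false.
Proof.
move=> c0; apply: (@while_exit _ gd_budget) => [[x [G|//] g b]|].
  rewrite /gd_test /gd_body /= => /andP[_ cb].
  have := line_search_budget x G g b.
  case: (line_search _ _ _ _) => -[v g'] b' /= b'b.
  have lt : (b' < b)%N by rewrite (leq_ltn_trans b'b)// ltn_subrL c0 (leq_trans c0).
  by case: ifP => // _; case: ifP => //= _; rewrite (leq_ltn_trans (leq_subr _ _)).
rewrite /gd_init; case: ifP => // _; case: ifP => //= _.
  by rewrite -subnDA leq_subr.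
by rewrite leq_subr.
Qed.

End GradientDescent.

(** Gradient descent with backtracking line search on the empirical risk of the
    first [n] points of [zs]; returns the last iterate and the unused budget. *)
Definition GD (R : realType) (d : nat) (T : Type) (f : 'rV[R]_d -> T -> R)
    (Cgrad Ceval : nat) (zs : nat -> T)
    (x0 : 'rV[R]_d) (n B : nat) (tau beta : R) : 'rV[R]_d * nat :=
  let s := gd_run (empirical_risk f zs n) (n * Cgrad) (n * Ceval) tau beta x0 B in
  (gd_point s, gd_budget s).

Definition rate (R : realType) (alpha : R) (n : nat -> nat) (B : nat) : R :=
  Num.max (Num.sqrt ((n B)%:R / B%:R)) ((n B)%:R `^ (- (alpha / (1 + alpha)))).

(* Main.v *)
Require Import Defs.
From HB Require Import structures.
From mathcomp Require Import all_boot all_order all_algebra finmap.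
From mathcomp Require Import all_classical all_reals all_analysis.
From mathcomp Require Import measurable_realfun ring lra zify.

Import Order.TTheory GRing.Theory Num.Theory.
Import numFieldNormedType.Exports.

Local Open Scope classical_set_scope.
Local Open Scope ring_scope.

Set Implicit Arguments.
Unset Strict Implicit.
Unset Printing Implicit Defensive.

(** Why the theorem holds.

    Write F for the risk, F_n for the empirical risk of a sample of size n and xs for
    the minimizer of F.  The function F_n may fail to be convex, but on a bounded
    region and outside of an event of small probability it behaves like F, because
    of three facts.
    - Its first two derivatives, and the Lipschitz constant of the second one, are
      bounded by a constant C: random bounds for the functions [f ^~ z] average out
      ([random_smoothness], [smooth_on_avg]), and Markov's inequality applies to
      their averages ([empirical_smoothness]).
    - It is uniformly close to F, by the weak law of large numbers on a finite net
      and equicontinuity ([weak_lln], [empirical_uniform]).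
    - Its gradient at xs is of order n^(-alpha/(1+alpha)).  It is an empirical mean
      of centered variables with a moment of order 1 + alpha; truncating them at
      n^(1/(1+alpha)) balances Chebyshev's inequality for the truncated variables
      and Markov's inequality for the tails ([truncated_lln], [moment_lln],
      [empirical_gradient]).

    The first two facts make F_n strongly convex on the region, without any limit
    theorem for Hessians: at one small fixed scale h, the second differences of F_n
    are within 4 e of those of F, where e is the uniform distance, hence at least
    c h^2 - 4 e, and they differ from the second derivatives of F_n by at most C h^3
    ([close_to_strongly_convex]).  The iterates stay in the region.  Steps are at
    most 1, so that a bound on the gradient keeps the next iterate in a slightly
    larger ball; there F_n is close to F, and since F_n decreases the iterate is back
    in a sublevel set of F, which is bounded ([sublevel_bounded],
    [good_event_bound]).

    The rest is deterministic convex optimization ([gd_run_bound]).  Smoothness bounds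
    the number of trials of each line search, so that the budget B pays for a number
    of steps of order B/n.  By strong convexity each step contracts the gap
    F_n(x) - F_n(xs), so that the gap at the output is at most of order n/B.  Finally,
    strong convexity at xs bounds the distance r from the output to xs by
    (mu/2) r^2 <= O(n/B) + |grad F_n(xs)| r, and r is of the order of the rate
    ([quadratic_bound]).

    Probabilities are meaningful for measurable sets only, so the output of the
    algorithm also has to be a random vector: measurability is propagated through its
    loops ([measurable_gd_point]).

    The two terms of the rate are monotone in n in opposite directions and cross when
    n is B^((1+alpha)/(1+3alpha)), where both are B^(-alpha/(1+3alpha)); this gives
    the lower bound ([rate_lower_bound]). *)

(** * Euclidean geometry of row vectors *)

Definition dotr (R : realType) (d : nat) (u v : 'rV[R]_d) : R :=
  \sum_(i < d) u ord0 i * v ord0 i.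

Section Euclid.
Context {R : realType} {d : nat}.
Implicit Types u v w : 'rV[R]_d.

Lemma dotrC u v : dotr u v = dotr v u.
Proof. by apply: eq_bigr => i _; rewrite mulrC. Qed.

Lemma dotrDl u v w : dotr (u + v) w = dotr u w + dotr v w.
Proof. by rewrite -big_split; apply: eq_bigr => i _; rewrite mxE mulrDl. Qed.

Lemma dotrZl a u v : dotr (a *: u) v = a * dotr u v.
Proof. by rewrite mulr_sumr; apply: eq_bigr => i _; rewrite mxE mulrA. Qed.

Lemma dotrNl u v : dotr (- u) v = - dotr u v.
Proof. by rewrite -scaleN1r dotrZl mulN1r. Qed.

Lemma dotrDr u v w : dotr w (u + v) = dotr w u + dotr w v.
Proof. by rewrite dotrC dotrDl !(dotrC w). Qed.

Lemma dotrZr a u v : dotr u (a *: v) = a * dotr u v.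
Proof. by rewrite dotrC dotrZl dotrC. Qed.

Lemma dotrNr u v : dotr u (- v) = - dotr u v.
Proof. by rewrite dotrC dotrNl dotrC. Qed.

Lemma dotr_ge0 u : 0 <= dotr u u.
Proof. by apply: sumr_ge0 => i _; rewrite -expr2 sqr_ge0. Qed.

Lemma enorm_ge0 u : 0 <= enorm u.
Proof. exact: sqrtr_ge0. Qed.

Lemma enorm_sqr u : enorm u ^+ 2 = dotr u u.
Proof.
rewrite sqr_sqrtr; last by apply: sumr_ge0 => i _; rewrite sqr_ge0.
by apply: eq_bigr => i _; rewrite expr2.
Qed.

Lemma enormZ a u : enorm (a *: u) = `|a| * enorm u.
Proof.
apply/eqP; rewrite -(@eqrXn2 _ 2)// ?mulr_ge0 ?enorm_ge0//.
by rewrite exprMn !enorm_sqr dotrZl dotrZr mulrA real_normK ?num_real// expr2.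
Qed.

Lemma enormN u : enorm (- u) = enorm u.
Proof. by rewrite -scaleN1r enormZ normrN1 mul1r. Qed.

Lemma enorm0 : enorm (0 : 'rV[R]_d) = 0.
Proof. by rewrite -(scale0r 0) enormZ normr0 mul0r. Qed.

Lemma coord_le_enorm u i : `|u ord0 i| <= enorm u.
Proof.
rewrite -(@ler_pXn2r _ 2)// ?nnegrE ?enorm_ge0// enorm_sqr.
rewrite real_normK ?num_real// /dotr (bigD1 i)//= expr2 lerDl.
by apply: sumr_ge0 => j _; rewrite -expr2 sqr_ge0.
Qed.

Lemma coord_le_norm u i : `|u ord0 i| <= `|u|.
Proof.
rewrite [leRHS]/Num.Def.normr/= mx_normrE.
exact: (le_bigmax _ (fun ij : 'I_1 * 'I_d => `|u ij.1 ij.2|) (ord0, i)).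
Qed.

Lemma norm_le_coord u a : 0 <= a -> (forall i, `|u ord0 i| <= a) -> `|u| <= a.
Proof.
move=> a0 ua; rewrite [leLHS]/Num.Def.normr/= mx_normrE.
by apply: bigmax_le => // -[i j] _ /=; rewrite (ord1 i).
Qed.

Lemma norm_le_enorm u : `|u| <= enorm u.
Proof. by apply: norm_le_coord => [|i]; [exact: enorm_ge0|exact: coord_le_enorm]. Qed.

Lemma enorm_le_norm u : enorm u <= d%:R * `|u|.
Proof.
rewrite -(@ler_pXn2r _ 2)// ?nnegrE ?enorm_ge0 ?mulr_ge0// enorm_sqr exprMn.
apply: (@le_trans _ _ (\sum_(i < d) `|u| ^+ 2)).
  apply: ler_sum => i _.
  by rewrite -expr2 -real_normK ?num_real// lerXn2r ?nnegrE// coord_le_norm.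
rewrite sumr_const card_ord -[leLHS]mulr_natl ler_wpM2r ?sqr_ge0//.
by rewrite -natrX ler_nat; case: (d) => // k; rewrite expnS expn1 leq_pmull.
Qed.

Lemma enorm_eq0 u : enorm u = 0 -> u = 0.
Proof.
by move=> u0; apply/eqP; rewrite -normr_le0 -u0 norm_le_enorm.
Qed.

(** Cauchy-Schwarz, from the nonnegativity of the squared norm of
    [|v|^2 u - <u, v> v]. *)
Lemma dotr_le u v : `|dotr u v| <= enorm u * enorm v.
Proof.
have [->|v0] := eqVneq v 0.
  rewrite enorm0 mulr0 (_ : dotr u 0 = 0) ?normr0//.
  by rewrite -(scale0r 0) dotrZr mul0r.
rewrite -(@ler_pXn2r _ 2)// ?nnegrE ?mulr_ge0 ?enorm_ge0//.
rewrite exprMn !enorm_sqr real_normK ?num_real//.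
have vv : 0 < dotr v v.
  rewrite lt_neqAle dotr_ge0 andbT eq_sym -enorm_sqr sqrf_eq0.
  by apply: contra v0 => /eqP /enorm_eq0 ->.
have := dotr_ge0 (dotr v v *: u - dotr u v *: v).
rewrite !(dotrDl, dotrDr, dotrNl, dotrNr, dotrZl, dotrZr) (dotrC v u).
move: vv; set a := dotr v v; set b := dotr u v; set c := dotr u u.
move=> a0 h; rewrite -(ler_pM2l a0); nra.
Qed.

End Euclid.

(** * Second order expansions along segments *)

Section Calculus.
Context {R : realType} {d : nat}.
Implicit Types (g : 'rV[R]_d -> R) (x y u v : 'rV[R]_d).

Lemma derive_dotr g x u : differentiable g x ->
  'D_u g x = dotr (gradient g x) u.
Proof.
move=> dg; rewrite deriveE// {1}(row_sum_delta u) linear_sum.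
apply: eq_bigr => i _; rewrite linearZ /= /gradient mxE deriveE//.
by rewrite mulrC.
Qed.

Lemma deriveZ_dir g x a u : differentiable g x ->
  'D_(a *: u) g x = a * 'D_u g x.
Proof. by move=> dg; rewrite !derive_dotr// dotrZr. Qed.

Lemma deriveN_dir g x u : differentiable g x -> 'D_(- u) g x = - 'D_u g x.
Proof. by move=> dg; rewrite -(scaleN1r u) deriveZ_dir// mulN1r. Qed.

Lemma derivable_line g x u (s : R) : derivable g (x + s *: u) u ->
  is_derive s (1 : R) (fun r : R => g (x + r *: u)) ('D_u g (x + s *: u)).
Proof.
have E : (fun h : R => h^-1 *: (((fun r : R => g (x + r *: u)) \o shift s) (h *: (1 : R))
             - g (x + s *: u))) =
         (fun h : R => h^-1 *: ((g \o shift (x + s *: u)) (h *: u) - g (x + s *: u))).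
  rewrite funeqE => h /=; congr (_ *: (g _ - _)).
  by rewrite [h *: 1]mulr1 scalerDl addrCA.
by move=> dg; split; rewrite /derivable /derive E.
Qed.

(** The mean value theorem is applied twice: to [p1], then to the difference of [p]
    and its quadratic minorant. *)
Lemma taylor2_ge (p p1 p2 : R -> R) (m : R) :
  (forall s : R, is_derive s (1 : R) p (p1 s)) ->
  (forall s : R, is_derive s (1 : R) p1 (p2 s)) ->
  (forall s : R, 0 <= s <= 1 -> m <= p2 s) ->
  p 0 + p1 0 + m / 2 <= p 1.
Proof.
move=> dp dp1 mp2.
have p1ge s : 0 <= s <= 1 -> p1 0 + m * s <= p1 s.
  move=> /andP[s0 s1].
  have [|c] := @MVT_segment R p1 p2 0 s s0 (fun t _ => dp1 t).
    by apply: derivable_within_continuous => t _; exact: ex_derive.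
  rewrite in_itv/= subr0 => /andP[c0 cs] e.
  have := mp2 c; rewrite c0 (le_trans cs s1) => /(_ isT) mc; nra.
have dq (s : R) : is_derive s (1 : R) (fun s => p s - p1 0 * s - m / 2 * s ^+ 2)
    (p1 s - p1 0 - m * s).
  have ? := dp s.
  apply: is_derive_eq; rewrite /GRing.scale /=; lra.
have [|c] := @MVT_segment R _ _ 0 1 ler01 (fun t _ => dq t).
  by apply: derivable_within_continuous => t _; exact: ex_derive.
rewrite in_itv/= => c01; have := p1ge _ c01; nra.
Qed.

Lemma taylor_ge g x u (m : R) :
  (forall z, differentiable g z) -> (forall z, differentiable ('D_u g) z) ->
  (forall s : R, 0 <= s <= 1 -> m <= 'D_u ('D_u g) (x + s *: u)) ->
  g x + 'D_u g x + m / 2 <= g (x + u).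
Proof.
move=> dg d2g h.
have D1 (s : R) : is_derive s (1 : R) (fun s => g (x + s *: u)) ('D_u g (x + s *: u)).
  by apply: derivable_line; exact: diff_derivable.
have D2 (s : R) : is_derive s (1 : R) (fun s => 'D_u g (x + s *: u))
    ('D_u ('D_u g) (x + s *: u)).
  by apply: derivable_line; exact: diff_derivable.
by have := taylor2_ge D1 D2 h; rewrite scale0r scale1r addr0.
Qed.

Lemma taylor_le g x u (m : R) :
  (forall z, differentiable g z) -> (forall z, differentiable ('D_u g) z) ->
  (forall s : R, 0 <= s <= 1 -> 'D_u ('D_u g) (x + s *: u) <= m) ->
  g (x + u) <= g x + 'D_u g x + m / 2.
Proof.
move=> dg d2g h.
have D1 (s : R) : is_derive s (1 : R) (fun s => - g (x + s *: u)) (- 'D_u g (x + s *: u)).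
  by apply: is_deriveN; apply: derivable_line; exact: diff_derivable.
have D2 (s : R) : is_derive s (1 : R) (fun s => - 'D_u g (x + s *: u))
    (- 'D_u ('D_u g) (x + s *: u)).
  by apply: is_deriveN; apply: derivable_line; exact: diff_derivable.
have := @taylor2_ge _ _ _ (- m) D1 D2.
rewrite scale0r scale1r addr0.
move=> H; suff: - g x - 'D_u g x + - m / 2 <= - g (x + u) by lra.
by apply: H => s s01; rewrite lerN2 h.
Qed.

(** Only pure second derivatives ['D_u ('D_u g)] are controlled, since all
    expansions are made along segments.  A single constant [L] serves for all the
    bounds, so that averaging functions averages their constants. *)
Record smooth_on (K : set 'rV[R]_d) (L : R) (g : 'rV[R]_d -> R) : Prop := {
  smooth_diff : forall x, differentiable g x;
  smooth_diff2 : forall u x, differentiable ('D_u g) x;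
  smooth_grad : forall x u, K x -> `|'D_u g x| <= L * enorm u;
  smooth_hess : forall x u, K x -> `|'D_u ('D_u g) x| <= L * enorm u ^+ 2;
  smooth_lip : forall x y u, K x -> K y ->
    `|'D_u ('D_u g) x - 'D_u ('D_u g) y| <= L * enorm (x - y) * enorm u ^+ 2 }.

Definition segment_closed (K : set 'rV[R]_d) := forall x u (s : R),
  K x -> K (x + u) -> 0 <= s <= 1 -> K (x + s *: u).

Lemma smooth_descent K L g x u : smooth_on K L g -> segment_closed K ->
  K x -> K (x + u) -> g (x + u) <= g x + 'D_u g x + L / 2 * enorm u ^+ 2.
Proof.
move=> [dg d2g _ hg _] cK Kx Kxu; rewrite mulrAC; apply: taylor_le => // s s01.
by apply: le_trans (hg _ _ _); [exact: ler_norm|exact: cK].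
Qed.

Lemma smooth_lipschitz K L g x u : smooth_on K L g -> segment_closed K ->
  K x -> K (x + u) -> `|g (x + u) - g x| <= L * enorm u.
Proof.
move=> [dg d2g gg _ _] cK Kx Kxu.
have D1 (s : R) : is_derive s (1 : R) (fun s => g (x + s *: u)) ('D_u g (x + s *: u)).
  by apply: derivable_line; exact: diff_derivable.
have [|c] := @MVT_segment R _ _ 0 1 ler01 (fun t _ => D1 t).
  by apply: derivable_within_continuous => t _; exact: ex_derive.
rewrite in_itv/= scale0r scale1r addr0 subr0 mulr1 => c01 ->.
by apply: gg; exact: cK.
Qed.

(** The first order terms of the expansions at [x + w] and [x - w] cancel, and the
    second derivative moves by at most [L * enorm w ^+ 3] along the segments. *)
Lemma second_difference_le K L g x w : smooth_on K L g -> segment_closed K ->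
  K x -> K (x + w) -> K (x - w) ->
  g (x + w) + g (x - w) - 2 * g x <= 'D_w ('D_w g) x + L * enorm w ^+ 3.
Proof.
move=> [dg d2g _ _ lg] cK Kx Kp Km.
have B v : v = w \/ v = - w -> K (x + v) ->
    g (x + v) <= g x + 'D_v g x + ('D_w ('D_w g) x + L * enorm w ^+ 3) / 2.
  move=> vw Kv; apply: taylor_le => // s s01.
  have -> : 'D_v ('D_v g) (x + s *: v) = 'D_w ('D_w g) (x + s *: v).
    case: vw => ->; first reflexivity.
    have Ew : 'D_(- w) g = - 'D_w g.
      by rewrite funeqE => z; rewrite deriveN_dir.
    rewrite Ew deriveN; last exact: diff_derivable.
    by rewrite deriveN_dir// opprK.
  have Ks := cK x v s Kx Kv s01.
  have := lg _ _ w Ks Kx; rewrite ler_norml => /andP[_].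
  rewrite lerBlDl => h; apply: (le_trans h); rewrite lerD2l.
  rewrite addrAC subrr add0r enormZ.
  have -> : enorm v = enorm w by case: vw => ->; rewrite ?enormN.
  have L0 : 0 <= L * enorm w ^+ 3.
    have [w0|w0] := eqVneq (enorm w) 0; first by rewrite w0 expr0n mulr0.
    have := lg _ _ w Kp Kx => /(le_trans (normr_ge0 _)).
    by rewrite addrAC subrr add0r -mulrA -exprS.
  case/andP: s01 => s0 s1; rewrite ger0_norm//.
  rewrite (_ : L * _ * _ = s * (L * enorm w ^+ 3)); last by ring.
  exact: ler_piMl.
have := B w (or_introl erefl) Kp; have := B (- w) (or_intror erefl) Km.
rewrite (deriveN_dir w (dg x)).
lra.
Qed.

Lemma derive2Z g x a u : (forall z, differentiable g z) ->
  (forall z, differentiable ('D_u g) z) ->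
  'D_(a *: u) ('D_(a *: u) g) x = a ^+ 2 * 'D_u ('D_u g) x.
Proof.
move=> dg d2g.
have -> : 'D_(a *: u) g = a \*: 'D_u g by rewrite funeqE => z; rewrite deriveZ_dir.
rewrite deriveZ; last exact: diff_derivable.
by rewrite deriveZ_dir// /GRing.scale /= mulrA expr2.
Qed.

(** The second differences of [g] at one fixed scale [h] inherit a lower bound from
    [F], and the Lipschitz bound on the second derivative turns it into a bound on
    the second derivative itself. *)
Lemma close_to_strongly_convex K L g F c e h x u : smooth_on K L g ->
  segment_closed K -> 0 < c ->
  (forall y z, K y -> K z ->
    F (2^-1 *: (y + z)) <= 2^-1 * F y + 2^-1 * F z - c / 8 * enorm (y - z) ^+ 2) ->
  (forall y, K y -> `|g y - F y| <= e) ->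
  0 < h -> L * h <= c / 4 -> 16 * e <= c * h ^+ 2 ->
  (forall w, enorm w = h -> K (x + w)) -> K x ->
  c / 2 * enorm u ^+ 2 <= 'D_u ('D_u g) x.
Proof.
move=> sg cK c0 FK gF h0 Lh eh Kw Kx.
have [->|u0] := eqVneq u 0.
  have := smooth_hess sg 0 Kx.
  by rewrite enorm0 expr0n /= !mulr0 normr_le0 => /eqP ->.
have nu : 0 < enorm u.
  rewrite lt_neqAle enorm_ge0 andbT eq_sym; apply: contra u0 => /eqP /enorm_eq0.
  by move=> ->.
(* The expansion is made at distance [h] of [x], in the direction of [u]. *)
set a := h / enorm u; have a0 : 0 < a by rewrite divr_gt0.
have wh : enorm (a *: u) = h by rewrite enormZ gtr0_norm// divfK// gt_eqF.
have Kp := Kw _ wh; have Km : K (x - a *: u) by apply: Kw; rewrite enormN.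
have := second_difference_le sg cK Kx Kp Km.
rewrite (derive2Z _ _ (smooth_diff sg) (smooth_diff2 sg u)) wh.
have := gF _ Kx; have := gF _ Kp; have := gF _ Km.
rewrite !ler_norml => /andP[m1 m2] /andP[p1 p2] /andP[x1 x2].
have := FK _ _ Kp Km.
have -> : 2^-1 *: (x + a *: u + (x - a *: u)) = x.
  by rewrite addrACA subrr addr0 -mulr2n -(scaler_nat 2 x) scalerA mulVf ?scale1r ?pnatr_eq0.
have -> : x + a *: u - (x - a *: u) = 2 *: (a *: u).
  by rewrite opprD opprK addrACA subrr add0r (scaler_nat 2) mulr2n.
rewrite enormZ wh exprMn real_normK ?num_real// => FF dd.
have uE : enorm u = h / a by rewrite /a invf_div mulrC divfK ?gt_eqF.
rewrite uE expr_div_n mulrA ler_pdivrMr ?exprn_gt0// [leRHS]mulrC.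
have h3 : h ^+ 3 = h * h ^+ 2 by rewrite exprS.
have : L * h ^+ 3 <= c / 4 * h ^+ 2 by rewrite h3 mulrA ler_wpM2r ?sqr_ge0.
lra.
Qed.

End Calculus.

(** * Gradient descent on a function that is well behaved near its iterates *)

Lemma while_inv (S : Type) (I : S -> Prop) (k : nat) (test : S -> bool)
    (body : S -> S) (s : S) :
  (forall t, I t -> test t -> I (body t)) -> I s -> I (while k test body s).
Proof.
by move=> st; elim: k s => //= k IH s Is; case: ifP => // ts; apply/IH/st.
Qed.

Section Descent.
Context {R : realType} {d : nat}.
Variables (g : 'rV[R]_d -> R) (K0 K1 : set 'rV[R]_d) (x0 xs : 'rV[R]_d).
Variables (mu L beta : R) (J cg ce : nat).
Hypotheses (mu_gt0 : 0 < mu) (L_ge0 : 0 <= L) (beta01 : 0 < beta < 1).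
Hypothesis betaJ : beta ^+ J * L <= 1.
Hypothesis ce_gt0 : (0 < ce)%N.
Hypothesis lower : forall x u, K1 x -> K1 (x + u) ->
  g x + dotr (gradient g x) u + mu / 2 * enorm u ^+ 2 <= g (x + u).
Hypothesis upper : forall x u, K1 x -> K1 (x + u) ->
  g (x + u) <= g x + dotr (gradient g x) u + L / 2 * enorm u ^+ 2.
Hypothesis trap : forall x v, K0 x -> 0 < v <= 1 -> K1 (x - v *: gradient g x).
Hypothesis level : forall x, K1 x -> g x <= g x0 -> K0 x.
Hypotheses (K01 : K0 `<=` K1) (K1xs : K1 xs) (K0x0 : K0 x0).

Let beta_gt0 : 0 < beta. Proof. by case/andP: beta01. Qed.
Let beta_le1 : beta <= 1. Proof. by case/andP: beta01 => _ /ltW. Qed.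

(** By [upper] the step [v] decreases [g] by at least [v - L / 2 * v ^+ 2] times the
    squared gradient, and [v * L <= 1]. *)
Lemma armijo x v : K0 x -> 0 < v <= 1 -> v * L <= 1 ->
  g (x - v *: gradient g x) <= g x - v / 2 * enorm (gradient g x) ^+ 2.
Proof.
move=> K0x v01 vL; have := upper (K01 K0x) (trap K0x v01).
rewrite dotrNr dotrZr enormN enormZ exprMn real_normK ?num_real// -enorm_sqr.
set G := enorm _ ^+ 2 => h; apply: (le_trans h).
have G0 : 0 <= G by rewrite sqr_ge0.
case/andP: v01 => v0 _; have : v * L * (v * G) <= v * G by rewrite ler_piMl// mulr_ge0// ltW.
lra.
Qed.

(** The step after [j] reductions is [beta ^+ j], so that [armijo] stops the search
    when [j = J] at the latest, unless the budget runs out before. *)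
Lemma line_search_spec x b : K0 x -> (ce <= b)%N ->
  let s := line_search g ce beta x (gradient g x) (g x) b in
  [/\ exists2 j, (j <= J)%N & s.1.1 = beta ^+ j,
      s.1.2 = g (x - s.1.1 *: gradient g x),
      (b <= s.2 + J.+1 * ce)%N &
      s.1.2 <= g x - s.1.1 / 2 * enorm (gradient g x) ^+ 2 \/ (s.2 < ce)%N].
Proof.
move=> K0x ceb; set s := line_search _ _ _ _ _ _ _.
pose I (t : R * R * nat) := exists j, [/\ (j <= J)%N, t.1.1 = beta ^+ j,
    t.1.2 = g (x - t.1.1 *: gradient g x) & (t.2 + j.+1 * ce = b)%N].
have [j [jJ sv sg sb]] : I s.
  apply: while_inv => [[[v g'] b'] /= [j [/= jJ -> -> bb]] /andP[lt cb]|]; last first.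
    by exists 0%N; rewrite expr0 scale1r mul1n subnK.
  exists j.+1; rewrite exprS; split=> //=; last by rewrite mulSn addnA subnK.
  rewrite ltn_neqAle jJ andbT; apply/negP => /eqP jE.
  have := @armijo x (beta ^+ j) K0x.
  by rewrite exprn_gt0// exprn_ile1 ?(ltW beta_gt0)// jE betaJ leNgt -jE lt => /(_ isT isT).
split => //; first by exists j.
  by rewrite -sb leq_add2l leq_mul2r ltnS jJ orbT.
have := line_search_exit g beta x (gradient g x) (g x) b ce_gt0.
rewrite -/s; case: (s) => [[v g'] b'] /= /negbT.
by rewrite negb_and -leNgt -ltnNge => /orP[]; [left|right].
Qed.

Let gap x := g x - g xs.
Let rho := mu * beta ^+ J.
Let kappa := (J.+1 * ce + cg)%N.
Let start := Num.max 0 (gap x0).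

(** Polyak-Lojasiewicz inequality: the right-hand side comes from the minimum over
    [u] of the quadratic minorant of [g (x + u)] given by [lower]. *)
Lemma gap_le_grad x : K1 x -> gap x <= enorm (gradient g x) ^+ 2 / (2 * mu).
Proof.
move=> K1x; have := @lower x (xs - x) K1x; rewrite [x + _]addrC subrK => /(_ K1xs).
have := dotr_le (gradient g x) (xs - x); rewrite ler_norml => /andP[+ _].
rewrite /gap; set G := enorm (gradient g x); set e := enorm _; set D := dotr _ _.
move=> h1 h2; rewrite ler_pdivlMr ?mulr_gt0//.
have h : g x - g xs <= G * e - mu / 2 * e ^+ 2 by lra.
have := ler_wpM2r (ltW mu_gt0) h; have := sqr_ge0 (mu * e - G).
by rewrite sqrrB exprMn; lra.
Qed.

(** By [gap_le_grad] an accepted step multiplies a positive gap by at most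
    [1 - rho], and [(1 - rho) * (1 + rho * N.+1%:R) <= 1 + rho * N%:R].  This gives
    only a decay of order [1 / N], which is what the final rate needs. *)
Lemma gap_step x y v (N : nat) : K1 x -> beta ^+ J <= v ->
  g y <= g x - v / 2 * enorm (gradient g x) ^+ 2 ->
  gap x * (1 + rho * N%:R) <= start -> gap y * (1 + rho * N.+1%:R) <= start.
Proof.
move=> K1x bv gyx gN.
have s0 : 0 <= start by rewrite le_max lexx.
have r0 : 0 < rho by rewrite mulr_gt0// exprn_gt0.
have N0 : (0 : R) <= N%:R by [].
have p0 : 0 < 1 + rho * N.+1%:R.
  by rewrite ltr_wpDr// mulr_ge0// ltW.
have [gy0|gy0] := leP (gap y) 0.
  by apply: (le_trans _ s0); rewrite mulr_le0_ge0// ltW.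
have gG := gap_le_grad K1x; rewrite ler_pdivlMr ?mulr_gt0// in gG.
have G0 := sqr_ge0 (enorm (gradient g x)).
have v0 : 0 < v by rewrite (lt_le_trans _ bv)// exprn_gt0.
have gyx' : gap y <= gap x - v * (mu * gap x) 
  by have := ler_wpM2l (ltW v0) gG; rewrite /gap; lra.
have gx0 : 0 < gap x.
  rewrite (lt_le_trans gy0)//; have := mulr_ge0 (ltW v0) G0; move: gyx; rewrite /gap; lra.
have : gap y <= gap x * (1 - rho).
  have := ler_wpM2r (ltW (mulr_gt0 mu_gt0 gx0)) bv; move: gyx'.
  rewrite /rho; set a := gap x; set b := gap y; lra.
move=> h; apply: (le_trans _ gN); apply: (le_trans (ler_wpM2r (ltW p0) h)).
rewrite -mulrA ler_pM2l// -natr1; nra.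
Qed.

(** [N] counts the accepted steps, each of cost at most [kappa].  The last
    alternative is a line search interrupted by lack of budget, which is charged
    to an unfinished step. *)
Let inv (B : nat) (s : gd_state) : Prop :=
  [/\ K0 (gd_point s), g (gd_point s) <= g x0,
      gd_grad s = None /\ (gd_budget s < cg)%N \/
        gd_grad s = Some (gradient g (gd_point s)),
      (ce <= gd_budget s)%N -> gd_grad s <> None -> gd_value s = g (gd_point s) &
      exists N : nat, gap (gd_point s) * (1 + rho * N%:R) <= start /\
        ((B <= gd_budget s + (cg + ce) + N * kappa)%N \/
         (gd_budget s < ce)%N /\ (B <= gd_budget s + (cg + ce) + N.+1 * kappa)%N)].

Lemma inv_init B : inv B (gd_init g cg ce x0 B).
Proof.
have st : exists N : nat, gap x0 * (1 + rho * N%:R) <= start.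
  by exists 0%N; rewrite mulr0 addr0 mulr1 le_max lexx orbT.
rewrite /gd_init; case: ifP => [cB|/negbT cB] /=; last first.
  split => //=; first by left; rewrite ltnNge.
  exists 0%N; split; last by left; lia.
  by rewrite mulr0 addr0 mulr1 le_max lexx orbT.
case: ifP => [eB|/negbT eB] /=; split => //=; try (by right);
  try (exists 0%N; split; [by rewrite mulr0 addr0 mulr1 le_max lexx orbT|left; lia]).
by move: eB => /negP.
Qed.

Lemma inv_body B s : inv B s -> gd_test ce 0 s -> inv B (gd_body g cg ce beta s).
Proof.
case: s => x [G|] gv b; last by [].
move=> [/= K0x xx0 [[//]|[->]] vE [N [gN bN]]] /andP[_ /= cb].
rewrite (vE cb)// /gd_body /=.
have {}bN : (B <= b + (cg + ce) + N * kappa)%N by move: bN; rewrite ltnNge cb => -[|[]].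
have := line_search_spec K0x cb.
case: (line_search _ _ _ _ _ _ _) => -[v g'] b' /= [[j jJ vb] gE bb acc].
have v0 : 0 < v by rewrite vb exprn_gt0.
have v1 : v <= 1 by rewrite vb exprn_ile1// ltW.
have vJ : beta ^+ J <= v by rewrite vb ler_wiXn2l// ltW.
have G0 := sqr_ge0 (enorm (gradient g x)).
case: ifP => [ok|/negbT nok]; last first.
  have {acc}b'ce : (b' < ce)%N by case: acc => //; rewrite (negbTE nok).
  split => //=; first by right.
  exists N; split=> //; right; split=> //.
  by rewrite mulSn {1}/kappa; move: bN bb; clear; move: (N * kappa)%N (J.+1 * ce)%N; lia.
have gx : g (x - v *: gradient g x) <= g x0.
  by apply: le_trans xx0; rewrite -gE (le_trans ok)// gerBl mulr_ge0// divr_ge0// ltW.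
have K0y : K0 (x - v *: gradient g x) by apply: level gx; apply: trap; rewrite ?v0.
have gN' : gap (x - v *: gradient g x) * (1 + rho * N.+1%:R) <= start.
  by apply: (gap_step (K01 K0x) vJ _ gN); rewrite -gE.
case: ifP => [cgb|/negbT cgb]; split => //=; try (by right).
- by exists N.+1; split => //; left; rewrite mulSn {1}/kappa; move: bN bb {gN'} cgb; clear;
  move: (N * kappa)%N (J.+1 * ce)%N; lia.
- by left; split=> //; rewrite ltnNge.
- by exists N.+1; split => //; left; rewrite mulSn {1}/kappa; move: bN bb {gN'} cgb; clear;
  move: (N * kappa)%N (J.+1 * ce)%N; lia.
Qed.

(** The loop ends either at a stationary point, where the gap is at most [0], or with
    too little budget for one more step, and then [N + 3] steps of cost [kappa]
    exhaust [B].  The term [enorm (gradient g xs) * e] accounts for [xs] not being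
    the minimizer of [g]. *)
Theorem gd_run_bound B : (0 < B)%N ->
  let e := enorm (gd_point (gd_run g cg ce 0 beta x0 B) - xs) in
  mu / 2 * e ^+ 2 <=
    start * kappa%:R / (Num.min 3^-1 rho * B%:R) + enorm (gradient g xs) * e.
Proof.
move=> B0 /=; set s := gd_run _ _ _ _ _ _ _.
have [K0x xx0 Gr vE [N [gN bN]]] : inv B s.
  by apply: while_inv => [t|]; [exact: inv_body|exact: inv_init].
set x := gd_point s in K0x xx0 Gr vE gN *.
have st0 : 0 <= start by rewrite le_max lexx.
have rho_gt0 : 0 < rho by rewrite mulr_gt0// exprn_gt0.
have m0 : 0 < Num.min 3^-1 rho by rewrite lt_min invr_gt0 ltr0n.
have BR : (0 : R) < B%:R by rewrite ltr0n.
apply: (@le_trans _ _ (gap x + enorm (gradient g xs) * enorm (x - xs))).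
  have := @lower xs (x - xs) K1xs; rewrite [xs + _]addrC subrK => /(_ (K01 K0x)).
  have := dotr_le (gradient g xs) (x - xs); rewrite ler_norml => /andP[+ _].
  rewrite /gap; lra.
rewrite lerD2r.
have bnd0 : 0 <= start * kappa%:R / (Num.min 3^-1 rho * B%:R).
  by rewrite divr_ge0 ?mulr_ge0// ltW.
have := @GD_loop_exit _ _ g cg ce 0 beta x0 B ce_gt0; rewrite -/s /gd_test.
have [G0|Gn0] := leP (enorm (gradient g x)) 0.
  move=> _; apply: le_trans bnd0; apply: (le_trans (gap_le_grad (K01 K0x))).
  have -> : enorm (gradient g x) = 0 by apply/eqP; rewrite eq_le G0 enorm_ge0.
  by rewrite expr0n mul0r.
move=> ex.
have {}BN : (B <= (N + 3) * kappa)%N.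
  have sb : (gd_budget s < kappa)%N.
    case: Gr => [[_ h]|h].
      by rewrite (leq_trans h)// leq_addl.
    move: ex; rewrite h Gn0 /= => /negbT; rewrite -ltnNge => h2.
    by rewrite (leq_trans h2)// /kappa mulSn -addnA leq_addr.
  have ck : (cg + ce <= kappa)%N by rewrite /kappa mulSn addnC leq_add2r leq_addr.
  move: bN sb ck; rewrite mulnDl mulSn; clear.
  move: (N * kappa)%N kappa (gd_budget s) => q k b; lia.
have [g0|g0] := leP (gap x) 0; first exact: le_trans bnd0.
rewrite ler_pdivlMr ?mulr_gt0//.
have BN' : B%:R <= (N%:R + 3) * kappa%:R :> R by rewrite -natrD -natrM ler_nat.
have mN : Num.min 3^-1 rho * (N%:R + 3) <= 1 + rho * N%:R.
  rewrite mulrDr addrC lerD//; last by rewrite ler_wpM2r// ge_min lexx orbT.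
  by rewrite -ler_pdivlMr ?ltr0n// div1r ge_min lexx.
apply: (@le_trans _ _ (gap x * (Num.min 3^-1 rho * ((N%:R + 3) * kappa%:R)))).
  by rewrite ler_pM2l// ler_pM2l.
have -> : gap x * (Num.min 3^-1 rho * ((N%:R + 3) * kappa%:R)) =
    gap x * (Num.min 3^-1 rho * (N%:R + 3)) * kappa%:R by rewrite !mulrA.
by rewrite ler_wpM2r// (le_trans _ gN)// ler_pM2l.
Qed.

End Descent.

(** * A truncated law of large numbers *)

Section Expectation.
Context {R : realType} {dO : measure_display} {Omega : measurableType dO}.
Variable P : probability Omega R.
Implicit Types X Y : Omega -> R.

Definition mean X : R := \int[P]_w X w.
Definition integrableR X := P.-integrable setT (EFin \o X).

Lemma integrableR_measurable X : integrableR X -> measurable_fun setT X.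
Proof. by move=> /integrableP[/measurable_EFinP]. Qed.

Lemma integrableR_le X Y : measurable_fun setT X -> integrableR Y ->
  (forall w, `|X w| <= Y w) -> integrableR X.
Proof.
move=> mX iY XY; apply: le_integrable iY => //; first exact/measurable_EFinP.
by move=> w _; rewrite lee_fin (le_trans (XY w))// ler_norm.
Qed.

Lemma integrableR_cst (k : R) : integrableR (fun=> k).
Proof. exact: finite_measure_integrable_cst. Qed.

Lemma integrableR_bounded X (k : R) : measurable_fun setT X ->
  (forall w, `|X w| <= k) -> integrableR X.
Proof. by move=> mX Xk; apply: (integrableR_le mX (integrableR_cst k)). Qed.

Lemma integrableRD X Y : integrableR X -> integrableR Y ->
  integrableR (fun w => X w + Y w).
Proof. by move=> iX iY; have := integrableD measurableT iX iY. Qed.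

Lemma integrableRZ k X : integrableR X -> integrableR (fun w => k * X w).
Proof. by move=> iX; have := integrableZl measurableT k iX. Qed.

Lemma integrableRB X Y : integrableR X -> integrableR Y ->
  integrableR (fun w => X w - Y w).
Proof. by move=> iX iY; have := integrableB measurableT iX iY. Qed.

Lemma integrableR_norm X : integrableR X -> integrableR (fun w => `|X w|).
Proof. by move=> iX; have := integrable_abse iX. Qed.

Lemma integrableR_sum n (X : 'I_n -> Omega -> R) :
  (forall i, integrableR (X i)) -> integrableR (fun w => \sum_(i < n) X i w).
Proof.
move=> iX; have := @integrable_sum _ _ _ P setT measurableT _ (index_enum 'I_n) predT
  (fun i => EFin \o X i) (fun i _ => iX i).
by congr (integrable _ _ _); apply/funext => w /=; rewrite sumEFin.
Qed.

Lemma meanD X Y : integrableR X -> integrableR Y ->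
  mean (fun w => X w + Y w) = mean X + mean Y.
Proof. exact: RintegralD. Qed.

Lemma meanB X Y : integrableR X -> integrableR Y ->
  mean (fun w => X w - Y w) = mean X - mean Y.
Proof. exact: RintegralB. Qed.

Lemma meanZ k X : integrableR X -> mean (fun w => k * X w) = k * mean X.
Proof. exact: RintegralZl. Qed.

Lemma mean_cst k : mean (fun=> k) = k.
Proof. by rewrite /mean Rintegral_cst//; have /= -> := @probability_setT _ _ _ P; rewrite mulr1. Qed.

Lemma mean_sum n (X : 'I_n -> Omega -> R) : (forall i, integrableR (X i)) ->
  mean (fun w => \sum_(i < n) X i w) = \sum_(i < n) mean (X i).
Proof.
elim: n X => [|n IH] X iX.
  by rewrite big_ord0 -[RHS](mean_cst 0); congr mean; apply/funext => w; rewrite big_ord0.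
rewrite big_ord_recr /= -IH// -meanD//; last exact: integrableR_sum.
by congr mean; apply/funext => w; rewrite big_ord_recr.
Qed.

Lemma le_mean X Y : integrableR X -> integrableR Y -> (forall w, X w <= Y w) ->
  mean X <= mean Y.
Proof. by move=> iX iY XY; apply: le_Rintegral. Qed.

Lemma mean_ge0 X : (forall w, 0 <= X w) -> 0 <= mean X.
Proof. by move=> X0; apply: Rintegral_ge0. Qed.

Lemma le_norm_mean X : integrableR X -> `|mean X| <= mean (fun w => `|X w|).
Proof. exact: le_normr_Rintegral. Qed.

Lemma EFin_mean X : integrableR X -> (mean X)%:E = (\int[P]_w (X w)%:E)%E.
Proof. by move=> iX; rewrite fineK// integrable_fin_num. Qed.

Lemma measurable_le_set (X Y : Omega -> R) : measurable_fun setT X ->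
  measurable_fun setT Y -> measurable [set w | X w <= Y w].
Proof.
by move=> mX mY; have := measurable_fun_ler mX mY measurableT (Y := [set true]) I; rewrite setTI.
Qed.

Lemma measurable_ge_set X (a : R) : measurable_fun setT X ->
  measurable [set w | a <= X w].
Proof. by move=> mX; apply: measurable_le_set. Qed.

Lemma markov_mean X a : 0 < a -> integrableR X -> (forall w, 0 <= X w) ->
  (P [set w | (a <= X w)%R] <= (mean X / a)%:E)%E.
Proof.
move=> a0 iX X0; have mX := integrableR_measurable iX.
have mEX : measurable_fun setT (EFin \o X) by exact/measurable_EFinP.
have := le_integral_abse P measurableT mEX a0.
rewrite setTI (_ : [set w | _] = [set w | a <= X w]); last first.
  by apply/seteqP; split => w /=; rewrite lee_fin ger0_norm.
under eq_integral do rewrite abse_EFin ger0_norm//.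
rewrite -EFin_mean// => h; rewrite mulrC EFinM.
by rewrite lee_pdivlMl.
Qed.

Lemma probability_union_le (A B : set Omega) (a b : R) : measurable A -> measurable B ->
  (P A <= a%:E)%E -> (P B <= b%:E)%E -> (P (A `|` B) <= (a + b)%:E)%E.
Proof.
move=> mA mB Aa Bb; apply: (le_trans (measureU2 _ mA mB)).
by rewrite EFinD leeD.
Qed.

End Expectation.

Section Truncation.
Context {R : realType} {dO : measure_display} {Omega : measurableType dO}.
Variable P : probability Omega R.
Implicit Types X Y : Omega -> R.

Let ident X Y := forall A : set R, measurable A -> P (X @^-1` A) = P (Y @^-1` A).

Definition independent2 X Y := forall A B : set R, measurable A -> measurable B ->
  P (X @^-1` A `&` Y @^-1` B) = (P (X @^-1` A) * P (Y @^-1` B))%E.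

(** Independence is required pairwise, which is what makes variances additive. *)
Record iid_sample X (Xs : nat -> Omega -> R) : Prop := {
  sample_measurable0 : measurable_fun setT X;
  sample_measurable : forall i, measurable_fun setT (Xs i);
  sample_ident : forall i, ident (Xs i) X;
  sample_indep : forall i j, i != j -> independent2 (Xs i) (Xs j) }.

Lemma iid_sample_comp X Xs (h : R -> R) : measurable_fun setT h ->
  iid_sample X Xs -> iid_sample (h \o X) (fun i => h \o Xs i).
Proof.
move=> mh [mX mXs id ind].
have mp A : measurable A -> measurable (h @^-1` A).
  by move=> mA; rewrite -[X in measurable X]setTI; exact: mh.
split; first exact: measurableT_comp.
- by move=> i; exact: measurableT_comp.
- by move=> i A mA; exact: (id i (h @^-1` A) (mp A mA)).
- by move=> i j ij A B mA mB; exact: (ind i j ij _ _ (mp A mA) (mp B mB)).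
Qed.

Lemma ident_integral X Y (h : R -> \bar R) : measurable_fun setT X ->
  measurable_fun setT Y -> ident X Y -> measurable_fun setT h ->
  (forall r, (0 <= h r)%E) ->
  (\int[P]_w h (X w) = \int[P]_w h (Y w))%E.
Proof.
move=> mX mY XY mh h0.
have := ge0_integral_pushforward mX P measurableT mh (fun y _ => h0 y).
have := ge0_integral_pushforward mY P measurableT mh (fun y _ => h0 y).
rewrite !preimage_setT => /= <- <-.
by apply: eq_measure_integral => A mA _; exact: XY.
Qed.

Lemma ident_integrable X Y : measurable_fun setT X ->
  measurable_fun setT Y -> ident X Y -> integrableR P Y -> integrableR P X.
Proof.
move=> mX mY XY /integrableP[_ Yoo]; apply/integrableP; split.
  exact/measurable_EFinP.
rewrite /= (@ident_integral X Y (fun r => `|r%:E|%E))//.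
by apply: measurableT_comp => //; exact: EFin_measurable.
Qed.

Lemma ident_mean X Y : measurable_fun setT X ->
  measurable_fun setT Y -> ident X Y -> mean P X = mean P Y.
Proof.
move=> mX mY XY; rewrite /mean /Rintegral; congr fine.
rewrite integralE [RHS]integralE; congr (_ - _)%E.
- rewrite (funepos_comp EFin X) (funepos_comp EFin Y).
  by apply: ident_integral => //; apply: measurable_funepos; exact: EFin_measurable.
- rewrite (funeneg_comp EFin X) (funeneg_comp EFin Y).
  by apply: ident_integral => //; apply: measurable_funeneg; exact: EFin_measurable.
Qed.

(** The joint law is the product law, so this is Fubini's theorem. *)
Lemma independent_mean X Y (k : R) : measurable_fun setT X -> measurable_fun setT Y ->
  independent2 X Y -> (forall w, `|X w| <= k) -> (forall w, `|Y w| <= k) ->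
  mean P (fun w => X w * Y w) = mean P X * mean P Y.
Proof.
move=> mX mY XY Xk Yk.
have k0 : 0 <= k by apply: le_trans (Xk point).
pose Xm : {mfun Omega >-> R} := mfun_Sub (mem_set mX).
pose Ym : {mfun Omega >-> R} := mfun_Sub (mem_set mY).
pose XYf w := (X w, Y w).
have mXY : measurable_fun setT XYf by apply: measurable_fun_pair.
pose mu := distribution P Xm; pose nu := distribution P Ym.
pose lam := pushforward P XYf.
have E A : measurable A -> (mu \x nu)%E A = lam A.
  apply: product_measure_unique => B C mB mC; rewrite -XY//.
pose p (z : R * R) := (z.1 * z.2)%:E.
have mp : measurable_fun setT p.
  apply/measurable_EFinP; apply: measurable_funM; [exact: measurable_fst|exact: measurable_snd].
have iXY : integrableR P (fun w => X w * Y w).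
  apply: (@integrableR_bounded _ _ _ P _ (k * k)); first exact: measurable_funM.
  by move=> w; rewrite normrM ler_pM.
have Elam : (\int[lam]_z p z = (mean P (fun w => X w * Y w))%:E)%E.
  by rewrite integral_pushforward// preimage_setT EFin_mean.
have iprod : (mu \x nu)%E.-integrable setT p.
  have /integrableP[_ fin] := integrable_pushforward mXY mp iXY measurableT.
  apply/integrableP; split=> //; apply: le_lt_trans fin.
  by rewrite le_eqVlt; apply/orP; left; apply/eqP/eq_measure_integral => A mA _; exact: E.
have int1 (Z : {mfun Omega >-> R}) (kZ : forall w, `|Z w| <= k) :
    (distribution P Z).-integrable setT EFin /\
    (\int[distribution P Z]_x x%:E = (mean P Z)%:E)%E.
  have iZ : integrableR P Z by apply: integrableR_bounded kZ.
  have mZ : measurable_fun setT Z by [].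
  split; first exact: (integrable_pushforward mZ (@EFin_measurable R setT) iZ).
  by rewrite integral_pushforward// preimage_setT EFin_mean.
have [imu Emu] := int1 Xm Xk; have [inu Enu] := int1 Ym Yk.
apply: EFin_inj; rewrite -Elam -(eq_measure_integral _ (fun A mA _ => E A mA)).
rewrite -integral12_prod_meas1//=.
have inner (x : R) : (\int[nu]_y p (x, y) = x%:E * (mean P Y)%:E)%E.
  transitivity (\int[nu]_y (x%:E * y%:E))%E; first by apply: eq_integral.
  by rewrite integralZl// Enu.
rewrite (eq_integral (fun x : R => x%:E * (mean P Y)%:E)%E); last by move=> x _; exact: inner.
by rewrite integralZr// Emu EFinM.
exact: mXY.
Qed.


Lemma sample_integrable X Xs i : iid_sample X Xs -> integrableR P X ->
  integrableR P (Xs i).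
Proof. by move=> [mX mXs id _]; apply: ident_integrable. Qed.

Lemma sample_mean X Xs i : iid_sample X Xs -> mean P (Xs i) = mean P X.
Proof. by move=> [mX mXs id _]; apply: ident_mean. Qed.

(** Markov's inequality: the expectation of an empirical mean does not depend on the
    sample size. *)
Lemma sample_markov X Xs (n : nat) (a : R) : iid_sample X Xs -> integrableR P X ->
  (forall w, 0 <= X w) -> (forall i w, 0 <= Xs i w) -> 0 < a -> (0 < n)%N ->
  (P [set w | (a <= (\sum_(i < n) Xs i w) / n%:R)%R] <= (mean P X / a)%:E)%E.
Proof.
move=> iidX iX X0 Xs0 a0 n0.
have iXs i := sample_integrable i iidX iX.
have iS : integrableR P (fun w => n%:R^-1 * \sum_(i < n) Xs i w).
  by apply/integrableRZ/integrableR_sum => i.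
have : mean P (fun w => n%:R^-1 * \sum_(i < n) Xs i w) = mean P X.
  rewrite meanZ; last by apply: integrableR_sum.
  rewrite (mean_sum (X := fun i : 'I_n => Xs i))//.
  under eq_bigr do rewrite (sample_mean _ iidX).
  by rewrite sumr_const card_ord -[X in _ * X]mulr_natl mulKf// pnatr_eq0 -lt0n.
move=> <-; have := markov_mean a0 iS.
under eq_set do rewrite mulrC.
apply=> w; rewrite mulr_ge0// ?invr_ge0//.
by apply: sumr_ge0 => i _.
Qed.

(** Chebyshev's inequality; the cross terms of the variance vanish by
    [independent_mean], which applies to variables bounded by [k]. *)
Lemma sample_chebyshev X Xs (n : nat) (k s : R) : iid_sample X Xs ->
  (forall w, `|X w| <= k) -> (forall i w, `|Xs i w| <= k) -> 0 < s -> (0 < n)%N ->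
  (P [set w | (s <= `|\sum_(i < n) (Xs i w - mean P X) / n%:R|)%R] <=
    (mean P (fun w => X w ^+ 2) / (n%:R * s ^+ 2))%:E)%E.
Proof.
move=> iidX Xk Xsk s0 n0; set m := mean P X.
have nR : (0 : R) < n%:R by rewrite ltr0n.
have [mX mXs id ind] := iidX.
have k0 : 0 <= k by apply: le_trans (Xk point).
have iX : integrableR P X by apply: integrableR_bounded Xk.
have mk : `|m| <= k.
  apply: (le_trans (le_norm_mean iX)); rewrite -[leRHS](mean_cst P).
  by apply: le_mean => //; [exact: integrableR_norm|exact: integrableR_cst].
pose Y i w := Xs i w - m.
have mY i : measurable_fun setT (Y i) by apply: measurable_funB.
have Yk i w : `|Y i w| <= k + k by rewrite (le_trans (ler_normB _ _))// lerD.
have k20 : 0 <= k + k by rewrite addr_ge0.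
have iYY i j : integrableR P (fun w => Y i w * Y j w).
  apply: (@integrableR_bounded _ _ _ P _ ((k + k) * (k + k))).
    exact: measurable_funM.
  by move=> w; rewrite normrM ler_pM.
have iXX : integrableR P (fun w => X w ^+ 2).
  apply: (@integrableR_bounded _ _ _ P _ (k ^+ 2)); first exact: measurable_funX.
  by move=> w; rewrite normrX lerXn2r ?nnegrE.
have YY i j : i != j -> mean P (fun w => Y i w * Y j w) = 0.
  move=> ij; rewrite (independent_mean (mY i) (mY j) _ (Yk i) (Yk j)).
    rewrite {1}/Y meanB ?mean_cst ?(sample_mean _ iidX) ?subrr ?mul0r//;
      [exact: sample_integrable iX|exact: integrableR_cst].
  move=> A B mA mB.
  have mS (C : set R) : measurable C -> measurable [set x : R | C (x - m)].
    move=> mC; have mf : measurable_fun setT (fun x : R => x - m).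
      exact: measurable_funB.
    by have := mf measurableT C mC; rewrite setTI.
  exact: (ind i j ij _ _ (mS A mA) (mS B mB)).
have YX i : mean P (fun w => Y i w * Y i w) <= mean P (fun w => X w ^+ 2).
  have -> : (fun w => Y i w * Y i w) =
      (fun w => (Xs i w ^+ 2 - (2 * m) * Xs i w) + m ^+ 2).
    by apply/funext => w; rewrite /Y; ring.
  have iXi := sample_integrable i iidX iX.
  have iXi2 : integrableR P (fun w => Xs i w ^+ 2).
    apply: (@integrableR_bounded _ _ _ P _ (k ^+ 2)); first exact: measurable_funX.
    by move=> w; rewrite normrX lerXn2r ?nnegrE.
  rewrite meanD ?mean_cst ?meanB ?meanZ ?(sample_mean _ iidX)//;
    try (exact: integrableR_cst); try (exact: integrableRZ);
    try (by apply: integrableRB => //; exact: integrableRZ).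
  have -> : mean P (fun w => Xs i w ^+ 2) = mean P (fun w => X w ^+ 2).
    apply: (sample_mean i (iid_sample_comp (h := fun x => x ^+ 2) _ iidX)).
    exact: exprn_measurable.
  rewrite -/m; have := sqr_ge0 m; lra.
pose S w := \sum_(i < n) Y i w / n%:R.
have S2 w : S w ^+ 2 = \sum_(i < n) \sum_(j < n) n%:R ^- 2 * (Y i w * Y j w).
  rewrite expr2 /S mulr_suml; apply: eq_bigr => i _.
  rewrite mulr_sumr; apply: eq_bigr => j _.
  by rewrite -exprVn; ring.
have S2f := funext S2.
have iS2 : integrableR P (fun w => S w ^+ 2).
  rewrite S2f.
  by apply: integrableR_sum => i; apply: integrableR_sum => j; exact: integrableRZ.
have ES : mean P (fun w => S w ^+ 2) <= mean P (fun w => X w ^+ 2) / n%:R.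
  rewrite S2f.
  rewrite (mean_sum (X := fun i w => \sum_(j < n) n%:R ^- 2 * (Y i w * Y j w))); last first.
    by move=> i; apply: integrableR_sum => j; exact: integrableRZ.
  apply: (@le_trans _ _ (\sum_(i < n) n%:R ^- 2 * mean P (fun w => X w ^+ 2))).
    apply: ler_sum => i _.
    rewrite (mean_sum (X := fun j w => n%:R ^- 2 * (Y i w * Y j w))); last first.
      by move=> j; exact: integrableRZ.
    rewrite (bigD1 i)//= meanZ// big1 ?addr0.
      by rewrite ler_wpM2l// invr_ge0 exprn_ge0.
    by move=> j ji; rewrite meanZ// YY ?mulr0// eq_sym.
  rewrite sumr_const card_ord -[leLHS]mulr_natl mulrA expr2 invfM mulrA.
  by rewrite divff ?gt_eqF// mul1r mulrC.
have s20 : 0 < s ^+ 2 by rewrite exprn_gt0.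
have := markov_mean s20 iS2 (fun w => sqr_ge0 _).
rewrite (_ : [set w | s ^+ 2 <= S w ^+ 2] = [set w | s <= `|S w|]); last first.
  apply/seteqP; split => w /=; rewrite -(@ler_pXn2r _ 2 _ s)// ?nnegrE ?(ltW s0)//;
    by rewrite real_normK ?num_real.
move=> h; apply: (le_trans h); rewrite lee_fin.
rewrite [leRHS](_ : _ = mean P (fun w => X w ^+ 2) / n%:R / s ^+ 2); last first.
  by rewrite invfM mulrA.
by rewrite ler_wpM2r// invr_ge0 ltW.
Qed.

Definition trunc (k x : R) : R := if `|x| <= k then x else 0.
Definition tail (k x : R) : R := if `|x| <= k then 0 else x.

Lemma trunc_tail k x : x = trunc k x + tail k x.
Proof. by rewrite /trunc /tail; case: ifP => _; rewrite ?addr0 ?add0r. Qed.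

Lemma measurable_trunc k : measurable_fun setT (trunc k).
Proof.
apply: measurable_fun_ifT => //; apply: measurable_fun_ler => //.
Qed.

Lemma measurable_tail k : measurable_fun setT (tail k).
Proof.
by apply: measurable_fun_ifT => //; apply: measurable_fun_ler.
Qed.

(** Chebyshev for the truncated part, Markov for the tail.  Letting [k] be a large
    constant gives the weak law of large numbers for integrable variables, and a
    level [k] growing with [n] gives the rate under a moment of order in ]1, 2]. *)
Lemma truncated_lln X Xs (n : nat) (k s : R) : iid_sample X Xs -> integrableR P X ->
  0 < k -> 0 < s -> (0 < n)%N ->
  (P [set w | (2 * s <= `|(\sum_(i < n) Xs i w) / n%:R - mean P X|)%R] <=
    (mean P (fun w => trunc k (X w) ^+ 2) / (n%:R * s ^+ 2) +
     2 * mean P (fun w => `|tail k (X w)|) / s)%:E)%E.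
Proof.
move=> iidX iX k0 s0 n0; have [mX mXs id ind] := iidX.
have nR : (0 : R) < n%:R by rewrite ltr0n.
have truncX := iid_sample_comp (measurable_trunc k) iidX.
have tailX := iid_sample_comp (measurable_tail k) iidX.
have trk x : `|trunc k x| <= k.
  by rewrite /trunc; case: ifPn => [//|_]; rewrite normr0 ltW.
have talk x : `|tail k x| <= `|x| by rewrite /tail; case: ifPn => [_|//]; rewrite normr0.
have itr : integrableR P (trunc k \o X).
  by apply: (@integrableR_bounded _ _ _ P _ k); [case: truncX|move=> w; exact: trk].
have ita : integrableR P (tail k \o X).
  apply: (integrableR_le _ (integrableR_norm iX)); first by case: tailX.
  by move=> w; exact: talk.
have EX : mean P X = mean P (trunc k \o X) + mean P (tail k \o X).
  by rewrite -meanD//; congr mean; apply/funext => w; exact: trunc_tail.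
set mt := mean P (trunc k \o X) in EX; set ml := mean P (tail k \o X) in EX.
have itas i := sample_integrable i tailX ita.
pose A := [set w | s <= `|\sum_(i < n) (trunc k (Xs i w) - mt) / n%:R| ].
pose Z i w := `|tail k (Xs i w) - ml|.
have iZ i : integrableR P (Z i).
  by apply: integrableR_norm; apply: (integrableRB (itas i)); exact: integrableR_cst.
pose W w := \sum_(i < n) n%:R^-1 * Z i w.
have iW : integrableR P W by apply: integrableR_sum => i; exact: integrableRZ.
pose B := [set w | s <= W w].
have mW := integrableR_measurable iW.
have mB : measurable B by apply: measurable_ge_set.
have mA : measurable A.
  apply: measurable_ge_set; apply: measurableT_comp => //.
  apply: measurable_sum => i; apply: measurable_funM => //; apply: measurable_funB => //.
  exact: measurableT_comp (measurable_trunc k) _.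
have sub : [set w | 2 * s <= `|(\sum_(i < n) Xs i w) / n%:R - mean P X| ] `<=` A `|` B.
  move=> w /= h; have [|sA] := leP s `|\sum_(i < n) (trunc k (Xs i w) - mt) / n%:R|.
    by left.
  right; rewrite /B /=.
  have E : (\sum_(i < n) Xs i w) / n%:R - mean P X =
      \sum_(i < n) (trunc k (Xs i w) - mt) / n%:R +
      \sum_(i < n) (tail k (Xs i w) - ml) / n%:R.
    rewrite -big_split /= EX mulr_suml.
    rewrite (_ : mt + ml = \sum_(i < n) (mt + ml) / n%:R); last first.
      by rewrite sumr_const card_ord -[RHS]mulr_natl mulrCA divff ?mulr1// gt_eqF.
    rewrite -sumrB; apply: eq_bigr => i _.
    by rewrite {1}(trunc_tail k (Xs i w)); ring.
  rewrite E in h; have h2 := le_trans h (ler_normD _ _).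
  have : `|\sum_(i < n) (tail k (Xs i w) - ml) / n%:R| <= W w.
    apply: (le_trans (ler_norm_sum _ _ _)); apply: ler_sum => i _.
    by rewrite normrM mulrC [X in X * _]ger0_norm ?invr_ge0.
  lra.
have mS : measurable [set w | 2 * s <= `|(\sum_(i < n) Xs i w) / n%:R - mean P X| ].
  apply: measurable_ge_set; apply: measurableT_comp => //.
  apply: measurable_funB => //; apply: measurable_funM => //; exact: measurable_sum.
apply: (le_trans (le_measure P _ _ sub)); rewrite ?inE//; first exact: measurableU.
apply: probability_union_le => //.
  by apply: (sample_chebyshev truncX _ _ s0 n0) => [w|i w]; exact: trk.
apply: (le_trans (markov_mean s0 iW _)) => [w|].
  by apply: sumr_ge0 => i _; rewrite mulr_ge0 ?invr_ge0 ?normr_ge0.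
rewrite lee_fin ler_wpM2r ?invr_ge0 ?(ltW s0)//.
rewrite (mean_sum (X := fun i w => n%:R^-1 * Z i w)); last first.
  by move=> i; exact: integrableRZ.
have E2 i : mean P (Z i) <= 2 * mean P (fun w => `|tail k (X w)|).
  have ml_le : `|ml| <= mean P (fun w => `|tail k (X w)|) by apply: le_norm_mean.
  have itan := integrableR_norm (itas i).
  apply: (@le_trans _ _ (mean P (fun w => `|tail k (Xs i w)| + `|ml|))).
    apply: le_mean => //; first by apply: integrableRD => //; exact: integrableR_cst.
    by move=> w; exact: ler_normB.
  rewrite meanD//; last exact: integrableR_cst.
  rewrite mean_cst.
  have := sample_mean i (iid_sample_comp (@normr_measurable R setT) tailX).
  rewrite /comp => ->; rewrite /comp in ml_le *; lra.
apply: (@le_trans _ _ (\sum_(i < n) n%:R^-1 * (2 * mean P (fun w => `|tail k (X w)|)))).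
  by apply: ler_sum => i _; rewrite meanZ// ler_wpM2l ?invr_ge0.
by rewrite sumr_const card_ord -[leLHS]mulr_natl mulrA divff ?mul1r// gt_eqF.
Qed.

End Truncation.

(** * Measurability of the output of gradient descent *)

Section VectorMeasurability.
Context {R : realType} {d : nat}.
Context {dO : measure_display} {Omega : measurableType dO}.

Lemma rat_vector_dense (x : 'rV[R]_d) (e : R) : 0 < e ->
  exists q : 'rV[rat]_d, `|x - map_mx ratr q| < e.
Proof.
move=> e0; have e20 : 0 < e / 2 by rewrite divr_gt0.
have /choice[q qP] : forall i : 'I_d, exists q : rat,
    ratr q \in `](x ord0 i - e / 2), (x ord0 i + e / 2)[%R.
  by move=> i; apply: rat_in_itvoo; lra.
exists (\row_i q i); apply: (@le_lt_trans _ _ (e / 2)); last by lra.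
apply: norm_le_coord => [|i]; first exact: ltW.
rewrite !mxE; have := qP i; rewrite in_itv /= => /andP[h1 h2].
by rewrite ler_norml; apply/andP; split; lra.
Qed.

Lemma measurable_norm_ball (x : Omega -> 'rV[R]_d) (c : 'rV[R]_d) (r : R) :
  (forall i, measurable_fun setT (fun w => x w ord0 i)) ->
  0 < r -> measurable [set w | `|c - x w| <= r].
Proof.
move=> mx r0.
rewrite (_ : [set w | _] = \bigcap_(i in [set: 'I_d]) [set w | `|c ord0 i - x w ord0 i| <= r]).
  apply: fin_bigcap_measurable => // i _; apply: measurable_le_set => //.
  by apply: measurableT_comp => //; exact: measurable_funB.
apply/seteqP; split => w /= h.
  by move=> i _; apply: le_trans h; have := coord_le_norm (c - x w) i; rewrite !mxE.
by apply: norm_le_coord => [|i]; [exact: ltW|have := h i I; rewrite !mxE].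
Qed.

(** Open sets of R^d are countable unions of balls with rational data. *)
Lemma measurable_vector (x : Omega -> 'rV[R]_d) :
  (forall i, measurable_fun setT (fun w => x w ord0 i)) ->
  measurable_fun setT (x : Omega -> borel 'rV[R]_d).
Proof.
move=> mx; apply: (@measurability _ _ Omega (borel 'rV[R]_d) setT x (@open 'rV[R]_d)) => //.
move=> _ [U oU <-]; rewrite setTI.
pose good (qk : 'rV[rat]_d * nat) :=
  (fun y : 'rV[R]_d => `|map_mx ratr qk.1 - y| <= qk.2.+1%:R^-1) `<=` U.
rewrite (_ : x @^-1` U = \bigcup_(qk : 'rV[rat]_d * nat)
    if `[< good qk >] then [set w | `|map_mx ratr qk.1 - x w| <= qk.2.+1%:R^-1] else set0).
  apply: countable_bigcupT_measurable => // qk; case: ifP => _ //.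
  by apply: measurable_norm_ball => //; rewrite invr_gt0.
apply/seteqP; split => w /=.
  move=> Uw; have /nbhs_ballP[e /= e0 eU] := open_nbhs_nbhs (conj oU Uw).
  have [k ke] : exists k : nat, k.+1%:R^-1 < e / 2.
    have e20 : 0 < e / 2 by rewrite divr_gt0.
    have := near_infty_natSinv_lt (PosNum e20) => -[k _ kP].
    by exists k; exact: (kP k (leqnn k)).
  have k0 : (0 : R) < k.+1%:R^-1 by rewrite invr_gt0.
  have [q qx] := rat_vector_dense (x w) k0.
  have gq : good (q, k).
    move=> y /= qy; apply: eU; rewrite -ball_normE /=.
    rewrite -(subrKA (map_mx ratr q)) (le_lt_trans (ler_normD _ _))//.
    by rewrite (splitr e) ltrD ?(lt_trans qx ke) ?(le_lt_trans qy ke).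
  by exists (q, k) => //; rewrite asboolT//= distrC ltW.
by case=> qk _; case: ifPn => // /asboolP gqk; exact: gqk.
Qed.

(** A directional derivative is the limit of the difference quotients with steps
    [k.+1%:R^-1]. *)
Lemma measurable_derive (D : Omega -> 'rV[R]_d -> R) (x : Omega -> 'rV[R]_d)
    (u : 'rV[R]_d) :
  (forall a : R, measurable_fun setT (fun w => D w (x w + a *: u))) ->
  (forall w, derivable (D w) (x w) u) ->
  measurable_fun setT (fun w => 'D_u (D w) (x w)).
Proof.
move=> mD dD.
pose h (k : nat) : R := k.+1%:R^-1.
apply: (@measurable_fun_cvg _ _ _ setT
  (fun k w => (h k)^-1 * (D w (x w + h k *: u) - D w (x w)))) => [k|w _].
  apply: measurable_funM => //; apply: measurable_funB => //.
  have := mD 0; congr (measurable_fun _ _); apply/funext => w.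
  by rewrite scale0r addr0.
have cv : (h k) @[k --> \oo] --> (0 : R)^'.
  move=> A [e /= e0 eA]; have [k0 _ kP] := near_infty_natSinv_lt (PosNum e0).
  exists k0 => // k /= k0k; apply: eA; last by rewrite invr_eq0 pnatr_eq0.
  by rewrite /= sub0r normrN ger0_norm ?invr_ge0//; exact: kP.
have dc := dD w; rewrite /derivable /= in dc.
have := cvg_comp _ _ cv dc; apply: cvg_trans; rewrite -/('D_u (D w) (x w)).
apply: near_eq_cvg; apply: nearW => k /=.
by rewrite [x w + _]addrC.
Qed.


Lemma measurable_enorm (x : Omega -> 'rV[R]_d) :
  (forall i, measurable_fun setT (fun w => x w ord0 i)) ->
  measurable_fun setT (fun w => enorm (x w)).
Proof.
move=> mx; apply: (@measurableT_comp _ _ _ _ _ _ (@Num.sqrt R)).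
  by apply: continuous_measurable_fun; exact: sqrt_continuous.
by apply: measurable_sum => i; exact: measurable_funX.
Qed.

End VectorMeasurability.

(** Measurability is propagated through the loops: the state of a loop run on a
    sample is a random element, described by its finitely many components. *)
Section LoopMeasurability.
Context {dO : measure_display} {Omega : measurableType dO} {S : Type}.
Variable M : (Omega -> S) -> Prop.
Hypothesis M_if : forall (b : Omega -> bool) s t, measurable_fun setT b ->
  M s -> M t -> M (fun w => if b w then s w else t w).

Lemma measurable_while (test : Omega -> S -> bool) (body : Omega -> S -> S)
    (k : nat) (s : Omega -> S) :
  (forall t, M t -> measurable_fun setT (fun w => test w (t w))) ->
  (forall t, M t -> M (fun w => body w (t w))) ->
  M s -> M (fun w => while k (test w) (body w) (s w)).
Proof.
move=> mt mb; elim: k s => [//|k IH] s Ms /=.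
by apply: M_if => //; [exact: mt|apply: IH; exact: mb].
Qed.

End LoopMeasurability.

(** Replaces the random number of iterations allowed to the line search by a
    deterministic one. *)
Lemma while_stable (S : Type) (test : S -> bool) (body : S -> S) (k l : nat) (s : S) :
  test (while k test body s) = false -> (k <= l)%N ->
  while l test body s = while k test body s.
Proof.
elim: k l s => [|k IH] [|l] s //=; first by move=> ->.
by case: ifP => // ts h kl; exact: IH.
Qed.

Section GDMeasurability.
Context {R : realType} {d : nat}.
Context {dO : measure_display} {Omega : measurableType dO}.
Variables (F : Omega -> 'rV[R]_d -> R) (beta : R) (cg ce : nat).
Hypothesis ce_gt0 : (0 < ce)%N.

Let mvec (x : Omega -> 'rV[R]_d) := forall i, measurable_fun setT (fun w => x w ord0 i).

Hypothesis F_meas : forall x, mvec x -> measurable_fun setT (fun w => F w (x w)).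
Hypothesis G_meas : forall x, mvec x -> mvec (fun w => gradient (F w) (x w)).

Let mls (s : Omega -> R * R * nat) := [/\ measurable_fun setT (fun w => (s w).1.1),
  measurable_fun setT (fun w => (s w).1.2) & measurable_fun setT (fun w => (s w).2)].

Let mvec_if (b : Omega -> bool) x y : measurable_fun setT b -> mvec x -> mvec y ->
  mvec (fun w => if b w then x w else y w).
Proof.
move=> mb mx my i; have := measurable_fun_ifT mb (mx i) (my i).
by congr (measurable_fun _ _); apply/funext => w; case: ifP.
Qed.

Let mvec_step x y (v : Omega -> R) : mvec x -> mvec y -> measurable_fun setT v ->
  mvec (fun w => x w - v w *: y w).
Proof.
move=> mx my mv i; under eq_fun do rewrite !mxE.
by apply: measurable_funB => //; exact: measurable_funM.
Qed.

Let mls_if (b : Omega -> bool) s t : measurable_fun setT b -> mls s -> mls t ->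
  mls (fun w => if b w then s w else t w).
Proof.
move=> mb [s1 s2 s3] [t1 t2 t3]; split.
- have := measurable_fun_ifT mb s1 t1.
  by congr (measurable_fun _ _); apply/funext => w; case: ifP.
- have := measurable_fun_ifT mb s2 t2.
  by congr (measurable_fun _ _); apply/funext => w; case: ifP.
- have := measurable_fun_ifT mb s3 t3.
  by congr (measurable_fun _ _); apply/funext => w; case: ifP.
Qed.

Let mls_search x G (g : Omega -> R) (b : Omega -> nat) (B : nat) :
  mvec x -> mvec G -> measurable_fun setT g -> measurable_fun setT b ->
  (forall w, (b w <= B)%N) ->
  mls (fun w => line_search (F w) ce beta (x w) (G w) (g w) (b w)).
Proof.
move=> mx mG mg mb bB.
rewrite (_ : (fun w => _) = fun w => while B (ls_test ce (g w) (G w))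
    (ls_body (F w) ce beta (x w) (G w)) (1, F w (x w - G w), (b w - ce)%N)); last first.
  apply/funext => w; rewrite /line_search (while_stable (k := (b w - ce)%N))//.
    exact: line_search_exit.
  exact: leq_trans (leq_subr _ _) (bB w).
apply: (@measurable_while _ _ _ mls) => //.
- move=> t [t1 t2 t3]; under eq_fun do rewrite (surjective_pairing (t _)) (surjective_pairing (t _).1).
  rewrite /ls_test; apply: measurable_and.
    apply: measurable_fun_ltr => //; apply: measurable_funB => //.
    apply: measurable_funM; first exact: measurable_funM.
    by apply: measurable_funX; exact: measurable_enorm.
  exact: measurable_fun_leq.
- move=> t [t1 t2 t3].
  under eq_fun do rewrite (surjective_pairing (t _)) (surjective_pairing (t _).1) /ls_body.
  split => /=.
  + exact: measurable_funM.
  + by apply: F_meas; apply: mvec_step => //; exact: measurable_funM.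
  + exact: measurable_fun_subn.
- split => //=; last exact: measurable_fun_subn.
  apply: F_meas => i; under eq_fun do rewrite !mxE.
  exact: measurable_funB.
Qed.

(** The deterministic bound on the budget also bounds the length of every line
    search.  A missing gradient is encoded by the pair of [isSome] and of a vector
    with default value [0]. *)
Let mgd (B : nat) (s : Omega -> gd_state) := [/\ mvec (fun w => gd_point (s w)),
  measurable_fun setT (fun w => isSome (gd_grad (s w))),
  mvec (fun w => odflt 0 (gd_grad (s w))),
  measurable_fun setT (fun w => gd_value (s w)) &
  measurable_fun setT (fun w => gd_budget (s w)) /\
    forall w, (gd_budget (s w) <= B)%N].

Let mgd_if B (b : Omega -> bool) s t : measurable_fun setT b -> mgd B s -> mgd B t ->
  mgd B (fun w => if b w then s w else t w).
Proof.
move=> mb [s1 s2 s3 s4 [s5 s6]] [t1 t2 t3 t4 [t5 t6]]; split.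
- have := mvec_if mb s1 t1.
  by congr mvec; apply/funext => w; case: ifP.
- have := measurable_fun_ifT mb s2 t2.
  by congr (measurable_fun _ _); apply/funext => w; case: ifP.
- have := mvec_if mb s3 t3.
  by congr mvec; apply/funext => w; case: ifP.
- have := measurable_fun_ifT mb s4 t4.
  by congr (measurable_fun _ _); apply/funext => w; case: ifP.
- split; last by move=> w; case: ifP.
  have := measurable_fun_ifT mb s5 t5.
  by congr (measurable_fun _ _); apply/funext => w; case: ifP.
Qed.

(** The body of the main loop as nested conditionals between states whose
    components are measurable. *)
Let gd_bodyE w (s : gd_state) : gd_body (F w) cg ce beta s =
  if isSome (gd_grad s) then
    let G := odflt 0 (gd_grad s) in
    let x := gd_point s in let g := gd_value s in
    let r := line_search (F w) ce beta x G g (gd_budget s) in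
    let x' := x - r.1.1 *: G in
    if r.1.2 <= g - r.1.1 / 2 * enorm G ^+ 2 then
      if (cg <= r.2)%N then GDState x' (Some (gradient (F w) x')) r.1.2 (r.2 - cg)
      else GDState x' None r.1.2 r.2
    else GDState x (Some G) g r.2
  else s.
Proof. by case: s => x [G|] g b //=; rewrite /gd_body /=; case: line_search => -[]. Qed.

Lemma measurable_gd_point (x0 : 'rV[R]_d) (B : nat) :
  forall i, measurable_fun setT (fun w => gd_point (gd_run (F w) cg ce 0 beta x0 B) ord0 i).
Proof.
suff [] : mgd B (fun w => gd_run (F w) cg ce 0 beta x0 B) by [].
have m0 : mvec (fun=> 0) by move=> i.
have mx0 : mvec (fun=> x0) by move=> i.
apply: (@measurable_while _ _ _ (mgd B)); first exact: mgd_if.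
- move=> t [t1 t2 t3 t4 [t5 t6]].
  rewrite (_ : (fun w => _) = fun w => isSome (gd_grad (t w)) &&
      ((0 < enorm (odflt 0 (gd_grad (t w)))) && (ce <= gd_budget (t w))%N)); last first.
    by apply/funext => w; rewrite /gd_test; case: (gd_grad _).
  apply: measurable_and => //; apply: measurable_and; last exact: measurable_fun_leq.
  by apply: measurable_fun_ltr => //; exact: measurable_enorm.
- move=> t mt; have [t1 t2 t3 t4 [t5 t6]] := mt.
  under eq_fun do rewrite gd_bodyE /=.
  have [l1 l2 l3] := mls_search t1 t3 t4 t5 t6.
  have mp := mvec_step t1 t3 l1.
  have lB w : ((line_search (F w) ce beta (gd_point (t w)) (odflt 0%R (gd_grad (t w)))
      (gd_value (t w)) (gd_budget (t w))).2 <= B)%N.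
    apply: leq_trans (t6 w); apply: leq_trans (leq_subr ce _).
    exact: line_search_budget.
  apply: mgd_if => //; apply: mgd_if.
  + apply: measurable_fun_ler => //; apply: measurable_funB => //.
    apply: measurable_funM; first exact: measurable_funM.
    by apply: measurable_funX; exact: measurable_enorm.
  + apply: mgd_if; first exact: measurable_fun_leq.
      split => //=; first exact: G_meas.
      split; first exact: measurable_fun_subn.
      by move=> w; exact: leq_trans (leq_subr _ _) (lB w).
    by split.
  + by split.
- rewrite /gd_init; case: (cg <= B)%N; last by split => //=.
  have mG0 := G_meas mx0.
  case: (ce <= B - cg)%N; split => //=.
  + exact: F_meas.
  + by split => // w; rewrite -subnDA leq_subr.
  + by split => // w; rewrite leq_subr.
Qed.

End GDMeasurability.

(** * Convergence in probability of empirical means *)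

Section LargeNumbers.
Context {R : realType} {dO : measure_display} {Omega : measurableType dO}.
Variable P : probability Omega R.

Definition eventually_rare (e : R) (E : nat -> set Omega) :=
  (forall n, measurable (E n)) /\
  exists N, forall n, (N <= n)%N -> (P (E n) <= e%:E)%E.

Lemma eventually_rareU a b E E' : eventually_rare a E -> eventually_rare b E' ->
  eventually_rare (a + b) (fun n => E n `|` E' n).
Proof.
move=> [mE [N NE]] [mE' [N' NE']]; split=> [n|]; first exact: measurableU.
exists (maxn N N') => n; rewrite geq_max => /andP[Nn N'n].
by apply: probability_union_le; [exact: mE|exact: mE'|exact: NE|exact: NE'].
Qed.

Lemma eventually_rare_seq (I : eqType) (s : seq I) (E : I -> nat -> set Omega) (e : R) :
  (forall i, eventually_rare e (E i)) ->
  eventually_rare ((size s)%:R * e) (fun n => \big[setU/set0]_(i <- s) E i n).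
Proof.
move=> hE; elim: s => [|i s IH].
  split=> [n|]; first by rewrite big_nil.
  by exists 0%N => n _; rewrite big_nil measure0 mul0r.
have := eventually_rareU (hE i) IH; rewrite /= -nat1r mulrDl mul1r.
by congr eventually_rare; apply/funext => n; rewrite big_cons.
Qed.

Definition average (Xs : nat -> Omega -> R) (n : nat) (w : Omega) : R :=
  (\sum_(i < n) Xs i w) / n%:R.

Lemma measurable_average Xs n : (forall i, measurable_fun setT (Xs i)) ->
  measurable_fun setT (average Xs n).
Proof. by move=> mXs; apply: measurable_funM => //; exact: measurable_sum. Qed.

Lemma measurable_deviation Xs n m a : (forall i, measurable_fun setT (Xs i)) ->
  measurable [set w | a <= `|average Xs n w - m| ].
Proof.
move=> mXs; apply: measurable_ge_set; apply: measurableT_comp => //.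
by apply: measurable_funB => //; exact: measurable_average.
Qed.

(** Dominated convergence. *)
Lemma tail_mean_small X (e : R) : integrableR P X -> 0 < e ->
  exists2 k : nat, (0 < k)%N & mean P (fun w => `|tail k%:R (X w)|) < e.
Proof.
move=> iX e0; have mX := integrableR_measurable iX.
pose f (k : nat) w := `|tail k%:R (X w)|.
have mf k : measurable_fun setT (f k).
  by apply: measurableT_comp => //; exact: measurableT_comp (@measurable_tail R _) mX.
have fX k w : `|f k w| <= `|X w|.
  by rewrite normr_id /tail; case: ifPn; rewrite ?normr0.
have [|||||_ _] := @dominated_convergence _ _ _ P setT measurableT
    (fun k w => (f k w)%:E) (fun=> 0%E) (fun w => `|X w|%:E) _ _ _ _ _.
- by move=> k; exact/measurable_EFinP.
- exact: measurable_cst.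
- apply/aeW => w _; apply/cvg_EFin; first by apply: nearW.
  have [k0 k0X] : exists k : nat, `|X w| <= k%:R.
    by exists (Num.truncn `|X w|).+1; rewrite ltW// truncnS_gt.
  apply: cvg_near_cst; exists k0 => // k /= kk.
  by rewrite /f /tail (le_trans k0X) ?ler_nat// normr0.
- exact: integrableR_norm.
- by apply/aeW => w k _; rewrite lee_fin.
rewrite integral0 => /fine_cvgP[_ /cvgrPdist_lt/(_ e e0)[N _ NP]].
exists N.+1 => //; have := NP N.+1 (leqnSn N).
rewrite /= sub0r normrN; apply: le_lt_trans.
exact: ler_norm.
Qed.

(** Weak law of large numbers: a large truncation level makes the tail term of
    [truncated_lln] small, and then a large [n] makes the variance term small. *)
Lemma weak_lln X Xs (a e : R) : iid_sample P X Xs -> integrableR P X ->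
  0 < a -> 0 < e -> eventually_rare e (fun n => [set w | a <= `|average Xs n w - mean P X| ]).
Proof.
move=> iidX iX a0 e0; have [_ mXs _ _] := iidX.
split=> [n|]; first exact: measurable_deviation.
have s0 : 0 < a / 2 by rewrite divr_gt0.
have [|k k0 kt] := @tail_mean_small X (e / 2 * (a / 2) / 2) iX.
  by rewrite !(divr_gt0, mulr_gt0).
have kR : (0 : R) < k%:R by rewrite ltr0n.
pose C := k%:R ^+ 2 / (a / 2) ^+ 2 / (e / 2).
exists (Num.truncn C).+1 => n nN.
have n0 : (0 < n)%N by exact: leq_ltn_trans nN.
have nR : (0 : R) < n%:R by rewrite ltr0n.
have Cn : C <= n%:R by rewrite (le_trans (ltW (truncnS_gt C)))// ler_nat.
have := truncated_lln iidX iX kR s0 n0.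
rewrite (_ : 2 * (a / 2) = a); last by lra.
move=> h; apply: (le_trans h); rewrite lee_fin (splitr e) lerD//; last first.
  rewrite ler_pdivrMr// mulrC; move: kt; lra.
have : mean P (fun w => trunc k%:R (X w) ^+ 2) <= k%:R ^+ 2.
  rewrite -[leRHS](mean_cst P); have mt := measurable_trunc (k%:R : R).
  have tk w : trunc k%:R (X w) ^+ 2 <= k%:R ^+ 2.
    rewrite /trunc; case: ifPn => [Xk|_]; last by rewrite expr0n sqr_ge0.
    by rewrite -[leLHS]real_normK ?num_real// lerXn2r ?nnegrE ?(ltW kR).
  apply: le_mean => //; last exact: integrableR_cst.
  apply: (@integrableR_bounded _ _ _ P _ (k%:R ^+ 2)) => [|w].
    by apply: measurable_funX; exact: (measurableT_comp mt (integrableR_measurable iX)).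
  by rewrite ger0_norm ?sqr_ge0.
move=> tk2; rewrite ler_pdivrMr ?mulr_gt0 ?exprn_gt0//; apply: (le_trans tk2).
move: Cn; rewrite /C ler_pdivrMr ?divr_gt0// ler_pdivrMr ?exprn_gt0//.
by rewrite (mulrCA (e / 2)) -(mulrA n%:R).
Qed.

(** At the truncation level [k = n `^ (1 + alpha)^-1], a moment of order [1 + alpha]
    bounds both error terms of [truncated_lln]: squares of truncated variables by
    [k `^ (1 - alpha)] times the moment, tails by [k `^ (- alpha)] times it. *)
Lemma moment_lln X Xs (alpha e : R) : iid_sample P X Xs -> integrableR P X ->
  0 < alpha <= 1 -> integrableR P (fun w => `|X w| `^ (1 + alpha)) -> 0 < e ->
  exists2 A : R, 0 < A & forall n, (0 < n)%N ->
    (P [set w | (A * n%:R `^ (- (alpha / (1 + alpha))) <=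
       `|average Xs n w - mean P X|)%R] <= e%:E)%E.
Proof.
move=> iidX iX /andP[a0 a1] iXa e0.
have a1p : 0 < 1 + alpha by rewrite addr_gt0.
have mX := integrableR_measurable iX.
set C := mean P (fun w => `|X w| `^ (1 + alpha)).
have C0 : 0 <= C by apply: mean_ge0 => w; exact: powR_ge0.
(* The two error terms sum to at most [C / A ^+ 2 + 2 * C / A <= 3 * C / A]. *)
pose A := 1 + 3 * C / e.
have A1 : 1 <= A by rewrite lerDl divr_ge0 ?mulr_ge0// ltW.
have A0 : 0 < A by rewrite (lt_le_trans _ A1).
exists (2 * A) => [|n n0]; first by rewrite mulr_gt0.
have nR : (0 : R) < n%:R by rewrite ltr0n.
pose k : R := n%:R `^ (1 + alpha)^-1.
have k0 : 0 < k by rewrite powR_gt0.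
pose q : R := n%:R `^ (- (alpha / (1 + alpha))).
have q0 : 0 < q by rewrite powR_gt0.
have s0 : 0 < A * q by rewrite mulr_gt0.
have := truncated_lln iidX iX k0 s0 n0.
rewrite mulrA => h; apply: (le_trans h); rewrite lee_fin.
have nn : (n%:R : R) != 0 by rewrite gt_eqF.
have imp : forall a b : R, (a + b == 0) ==> (n%:R != 0 :> R) by move=> *; apply/implyP.
have kq : k `^ (- alpha) = q by rewrite /k /q -powRrM mulrN mulrC.
have kn : k `^ (1 - alpha) = n%:R * q ^+ 2.
  rewrite /k /q -powR_mulrn ?powR_ge0// -2!powRrM -{2}(powRr1 (ltW nR)) -powRD//.
  by congr (_ `^ _); field; rewrite gt_eqF.
have T1 : mean P (fun w => trunc k (X w) ^+ 2) <= k `^ (1 - alpha) * C.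
  have tp x : trunc k x ^+ 2 <= k `^ (1 - alpha) * `|x| `^ (1 + alpha).
    rewrite /trunc; case: ifPn => [xk|_]; last by rewrite expr0n mulr_ge0 ?powR_ge0.
    have [->|x0] := eqVneq x 0; first by rewrite expr0n mulr_ge0 ?powR_ge0.
    have nx : 0 < `|x| by rewrite normr_gt0.
    rewrite -real_normK ?num_real// -powR_mulrn// (_ : 2%:R = (1 - alpha) + (1 + alpha)); last by lra.
    rewrite powRD; last by apply/implyP => _; rewrite gt_eqF.
    by rewrite ler_wpM2r ?powR_ge0// ge0_ler_powR ?nnegrE ?(ltW k0) ?subr_ge0.
  rewrite /C -meanZ//; apply: le_mean => //; last exact: integrableRZ.
  apply: (integrableR_le _ (integrableRZ (k `^ (1 - alpha)) iXa)) => [|w].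
    by apply: measurable_funX; exact: (measurableT_comp (measurable_trunc k) mX).
  by rewrite ger0_norm ?sqr_ge0.
have T2 : mean P (fun w => `|tail k (X w)|) <= k `^ (- alpha) * C.
  have tp x : `|tail k x| <= k `^ (- alpha) * `|x| `^ (1 + alpha).
    rewrite /tail; case: ifPn => [_|]; first by rewrite normr0 mulr_ge0 ?powR_ge0.
    rewrite -ltNge => kx; have nx : 0 < `|x| := lt_trans k0 kx.
    rewrite -[leLHS](powRr1 (ltW nx)) {1}(_ : 1 = - alpha + (1 + alpha)); last by lra.
    rewrite powRD; last by apply/implyP => _; rewrite gt_eqF.
    rewrite ler_wpM2r ?powR_ge0// !powRN lef_pV2 ?posrE ?powR_gt0//.
    by rewrite ge0_ler_powR ?nnegrE ?ltW.
  rewrite /C -meanZ//; apply: le_mean => //; last exact: integrableRZ.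
  apply: (integrableR_le _ (integrableRZ (k `^ (- alpha)) iXa)) => [|w].
    by apply: measurableT_comp => //; exact: (measurableT_comp (measurable_tail k) mX).
  by rewrite ger0_norm.
apply: (@le_trans _ _ (C / A ^+ 2 + 2 * C / A)).
  apply: lerD.
    rewrite ler_pdivrMr ?mulr_gt0 ?exprn_gt0//; apply: (le_trans T1); rewrite kn.
    rewrite exprMn le_eqVlt; apply/orP; left; apply/eqP; field.
    by rewrite gt_eqF.
  rewrite ler_pdivrMr// kq in T2 *; apply: (@le_trans _ _ (2 * (q * C))); first by rewrite ler_pM2l.
  rewrite le_eqVlt; apply/orP; left; apply/eqP; field.
  by rewrite gt_eqF.
apply: (@le_trans _ _ (3 * C / A)).
  rewrite (_ : 3 * C / A = C / A + 2 * C / A); last by field; rewrite gt_eqF.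
  rewrite lerD2r ler_wpM2l// lef_pV2 ?posrE ?exprn_gt0//.
  by rewrite expr2 ler_peMl// ltW.
rewrite ler_pdivrMr// /A mulrDr mulr1 mulrCA divff ?gt_eqF// mulr1.
by rewrite lerDr ltW.
Qed.

End LargeNumbers.

(** * Real samples drawn from an i.i.d. sequence of random elements *)

Section RealSamples.
Context {R : realType} {dO : measure_display} {Omega : measurableType dO}.
Variable P : probability Omega R.
Context {T : ptopologicalType}.
Variables (Z : Omega -> borel T) (Zs : nat -> Omega -> borel T).
Hypotheses (mZ : measurable_fun setT Z) (iidZ : iid_copies P Z Zs).

Lemma iid_copies_sample (g : borel T -> R) : measurable_fun setT g ->
  iid_sample P (g \o Z) (fun i => g \o Zs i).
Proof.
move=> mg; have [mZs id ind] := iidZ.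
have mp (A : set R) : measurable A -> measurable (g @^-1` A).
  by move=> mA; rewrite -[X in measurable X]setTI; exact: mg.
split; first exact: measurableT_comp.
- by move=> i; exact: measurableT_comp.
- by move=> i A mA; exact: (id i (g @^-1` A) (mp A mA)).
- move=> i j ij A B mA mB.
  pose C k := if k == i then g @^-1` A else g @^-1` B.
  have := ind [fset i; j]%fset C.
  rewrite big_fsetU1 ?inE//= big_seq_fset1 /C eqxx eq_sym (negbTE ij).
  rewrite (_ : \bigcap_(k in _) _ = (g \o Zs i) @^-1` A `&` (g \o Zs j) @^-1` B); last first.
    apply/seteqP; split => w /= h.
      split; first by have := h i; rewrite /= !inE !eqxx; apply.
      by have := h j; rewrite /= !inE !eqxx orbT eq_sym (negbTE ij); apply.
    move=> k /=; rewrite !inE => /orP[] /eqP ->; first by rewrite eqxx; case: h.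
    by rewrite eq_sym (negbTE ij); case: h.
  by apply => k; case: ifP => _; exact: mp.
Qed.

End RealSamples.

(** * Smoothness bounds from the entries of the Hessian *)

Section HessianEntries.
Context {R : realType} {d : nat}.
Implicit Types (g : 'rV[R]_d -> R) (x y u v : 'rV[R]_d) (A : 'M[R]_d).

Lemma dotr_delta u i : dotr (delta_mx ord0 i) u = u ord0 i.
Proof.
rewrite /dotr (bigD1 i)//= big1 ?addr0 => [|j ji].
  by rewrite !mxE !eqxx mul1r.
by rewrite !mxE (negbTE ji) andbF mul0r.
Qed.

Lemma enorm_delta i : enorm (delta_mx ord0 i : 'rV[R]_d) = 1.
Proof.
apply/eqP; rewrite -(@eqrXn2 _ 2)// ?enorm_ge0// enorm_sqr dotr_delta.
by rewrite mxE !eqxx expr1n.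
Qed.

Lemma delta_mulmx i j A : ((delta_mx ord0 i : 'rV[R]_d) *m A) ord0 j = A i j.
Proof.
rewrite mxE (bigD1 i)//= big1 ?addr0 => [|k ki].
  by rewrite mxE !eqxx mul1r.
by rewrite mxE (negbTE ki) andbF mul0r.
Qed.

(** [opnorm] is a supremum, so that the set of values has to be bounded first. *)
Lemma entry_le_opnorm A i j : `|A i j| <= opnorm A.
Proof.
rewrite -delta_mulmx.
apply: (le_trans (coord_le_enorm _ _)); apply: ub_le_sup; last first.
  by exists (delta_mx ord0 i) => //=; rewrite enorm_delta.
exists (d%:R * (\sum_k \sum_l `|A k l|)) => _ [u /= u1 <-].
apply: (le_trans (enorm_le_norm _)); rewrite ler_wpM2l//.
apply: norm_le_coord => [|l]; first by do 2![apply: sumr_ge0 => ? _].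
rewrite mxE; apply: (le_trans (ler_norm_sum _ _ _)); apply: ler_sum => k _.
rewrite normrM (bigD1 l)//= -[leLHS]addr0 lerD//; last by apply: sumr_ge0.
by rewrite ler_piMl// (le_trans (coord_le_enorm _ _)).
Qed.

Lemma dotr_mulmx_le A u v (b : R) : (forall i j, `|A i j| <= b) ->
  `|dotr (u *m A) v| <= d%:R ^+ 2 * b * (enorm u * enorm v).
Proof.
move=> Ab; rewrite /dotr.
have -> : \sum_(j < d) (u *m A) ord0 j * v ord0 j =
    \sum_(j < d) \sum_(i < d) u ord0 i * A i j * v ord0 j.
  by apply: eq_bigr => j _; rewrite mxE mulr_suml.
apply: (le_trans (ler_norm_sum _ _ _)).
apply: (@le_trans _ _ (\sum_(j < d) \sum_(i < d) b * (enorm u * enorm v))); last first.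
  by rewrite !sumr_const card_ord -mulrnA -[leLHS]mulr_natl natrM expr2 !mulrA.
apply: ler_sum => j _; apply: (le_trans (ler_norm_sum _ _ _)); apply: ler_sum => i _.
rewrite !normrM mulrAC mulrC ler_pM ?mulr_ge0//.
by rewrite ler_pM ?coord_le_enorm.
Qed.

Section C2.
Variable g : 'rV[R]_d -> R.
Hypothesis C2 : twice_continuously_differentiable g.

Let dg x : differentiable g x. Proof. by case: C2. Qed.
Let dgrad x : differentiable (gradient g) x. Proof. by case: C2. Qed.

Lemma derive_gradE v : 'D_v g =
  \sum_(j < d) (v ord0 j \*: (fun x => gradient g x ord0 j : R)).
Proof.
apply/funext => x; rewrite derive_dotr// fct_sumE /dotr.
by apply: eq_bigr => j _; rewrite mulrC.
Qed.

Let dgradj j x : differentiable (fun x => gradient g x ord0 j : R) x.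
Proof.
apply: (@differentiable_comp _ _ _ _ (gradient g) (fun N : 'rV[R]_d => N ord0 j : R)) => //.
exact: differentiable_coord.
Qed.

Lemma C2_diff2 v x : differentiable ('D_v g) x.
Proof.
by rewrite derive_gradE; apply: differentiable_sum => j; exact: differentiableZ.
Qed.

Lemma hessianE u v x : 'D_u ('D_v g) x = dotr (u *m hessian g x) v.
Proof.
rewrite derive_gradE derive_sum; last first.
  by move=> j; apply: diff_derivable; exact: differentiableZ.
apply: eq_bigr => j _; rewrite deriveZ; last exact: diff_derivable.
rewrite /hessian -deriveEjacobian// derive_mx; last exact: diff_derivable.
by rewrite mxE mulrC.
Qed.

Lemma hessian_entryE i j x :
  hessian g x i j = 'D_(delta_mx ord0 i) ('D_(delta_mx ord0 j) g) x.
Proof. by rewrite hessianE dotrC dotr_delta delta_mulmx. Qed.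

(** The Hessian is controlled by its value at [c] and its Lipschitz constant, then
    the gradient by its value at [c] and the Hessian on the way from [c].  A
    Euclidean distance to [c] is at most [d%:R * rho]. *)
Lemma smooth_from_entries (c : 'rV[R]_d) (rho a b m : R) : (0 < d)%N ->
  0 <= rho -> 0 <= b -> 0 <= m ->
  (forall i, `|gradient g c ord0 i| <= a) ->
  (forall i j, `|hessian g c i j| <= b) ->
  (forall x y i j, `|x - c| <= rho -> `|y - c| <= rho ->
    `|hessian g x i j - hessian g y i j| <= m * enorm (x - y)) ->
  smooth_on [set x | `|x - c| <= rho]
    (d%:R * a + d%:R ^+ 2 * (b + m * (d%:R * rho + 1)) * (d%:R * rho + 1)) g.
Proof.
move=> d0 rho0 b0 m0 ga hb hm; set D : R := d%:R.
have D1 : 1 <= D by rewrite /D ler1n.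
have D0 : 0 <= D by rewrite (le_trans ler01).
have a0 : 0 <= a by apply: le_trans (ga (Ordinal d0)).
have Dr : 0 <= D * rho by rewrite mulr_ge0.
set r := D * rho + 1; have r1 : 1 <= r by rewrite lerDr.
have r0 : 0 <= r by rewrite (le_trans ler01).
set L := D * a + _.
have cc : `|c - c| <= rho by rewrite subrr normr0.
have hx x i j : `|x - c| <= rho -> `|hessian g x i j| <= b + m * r.
  move=> xc; rewrite -(subrK (hessian g c i j) (hessian g x i j)).
  rewrite (le_trans (ler_normD _ _))// addrC lerD//.
  apply: (le_trans (hm _ _ _ _ xc cc)); rewrite ler_wpM2l//.
  rewrite (le_trans (enorm_le_norm _))// (@le_trans _ _ (D * rho))//; last by rewrite lerDl.
  by rewrite ler_wpM2l.
have bmr0 : 0 <= b + m * r by rewrite addr_ge0// mulr_ge0.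
have DbL : D ^+ 2 * (b + m * r) <= L.
  have h0 : 0 <= D ^+ 2 * (b + m * r) by rewrite mulr_ge0// sqr_ge0.
  have : D ^+ 2 * (b + m * r) <= D ^+ 2 * (b + m * r) * r by rewrite ler_peMr.
  by have := mulr_ge0 D0 a0; rewrite /L; lra.
split => //; first by move=> u x; exact: C2_diff2.
- move=> x u xc.
  have D1' (s : R) : is_derive s (1 : R) (fun s => 'D_u g (c + s *: (x - c)))
      ('D_(x - c) ('D_u g) (c + s *: (x - c))).
    by apply: derivable_line; apply: diff_derivable; exact: C2_diff2.
  have [|s] := @MVT_segment R _ _ 0 1 ler01 (fun t _ => D1' t).
    by apply: derivable_within_continuous => t _; exact: ex_derive.
  have cx : c + (x - c) = x by rewrite addrC subrK.
  rewrite in_itv/= scale0r scale1r addr0 subr0 mulr1 cx => /andP[s0 s1].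
  set y := c + s *: (x - c); move=> e.
  have yc : `|y - c| <= rho.
    rewrite /y addrAC subrr add0r normrZ ger0_norm//.
    by rewrite (le_trans _ xc)// ler_piMl.
  have h1 : `|'D_u g c| <= D * a * enorm u.
    rewrite derive_dotr// /dotr; apply: (le_trans (ler_norm_sum _ _ _)).
    apply: (@le_trans _ _ (\sum_(i < d) a * enorm u)).
      by apply: ler_sum => i _; rewrite normrM ler_pM// coord_le_enorm.
    by rewrite sumr_const card_ord -[leLHS]mulr_natl mulrA.
  have h2 : `|'D_(x - c) ('D_u g) y| <= D ^+ 2 * (b + m * r) * (r * enorm u).
    rewrite hessianE; apply: (le_trans (dotr_mulmx_le _ _ (fun i j => hx y i j yc))).
    rewrite ler_wpM2l ?mulr_ge0 ?sqr_ge0// ler_wpM2r ?enorm_ge0//.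
    rewrite (le_trans (enorm_le_norm _))// (@le_trans _ _ (D * rho))//; last by rewrite lerDl.
    by rewrite ler_wpM2l.
  have -> : 'D_u g x = 'D_u g c + 'D_(x - c) ('D_u g) y by rewrite -e addrC subrK.
  rewrite (le_trans (ler_normD _ _))// /L mulrDl lerD//.
  by rewrite -mulrA.
- move=> x u xc; rewrite hessianE.
  apply: (le_trans (dotr_mulmx_le _ _ (fun i j => hx x i j xc))).
  by rewrite -expr2 ler_wpM2r ?sqr_ge0.
- move=> x y u xc yc; rewrite !hessianE -dotrNl -dotrDl -mulmxBr.
  have hxy i j : `|(hessian g x - hessian g y) i j| <= m * enorm (x - y).
    by rewrite [X in `|X|]mxE [X in _ + X]mxE; exact: hm.
  apply: (le_trans (dotr_mulmx_le _ _ hxy)); rewrite -expr2 ler_wpM2r ?sqr_ge0//.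
  rewrite mulrA ler_wpM2r ?enorm_ge0// (le_trans _ DbL)// ler_wpM2l ?sqr_ge0//.
  by rewrite -[leLHS]add0r lerD// ler_peMr.
Qed.

End C2.
End HessianEntries.

(** * Random smoothness bounds *)

Section Balls.
Context {R : realType} {d : nat}.
Implicit Types (c x u : 'rV[R]_d).

(** Balls of the sup norm: their topology is the usual one, and they contain the
    Euclidean balls of the same radius. *)
Definition cball c (rho : R) : set 'rV[R]_d := [set x | `|x - c| <= rho].

Lemma cball_compact c rho : compact (cball c rho).
Proof.
apply: bounded_closed_compact.
  exists (`|c| + rho); split; first exact: num_real.
  move=> M cM x /= xc; rewrite -(subrK c x) (le_trans (ler_normD _ _))//.
  by rewrite addrC (le_trans _ (ltW cM))// lerD2l.
apply: (@closed_comp _ _ (fun x : 'rV[R]_d => `|x - c|) [set r : R | r <= rho]).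
  move=> x _; apply: continuous_comp; last exact: norm_continuous.
  by apply: continuousB; [exact: cvg_id|exact: cst_continuous].
exact: closed_le.
Qed.

Lemma cball_segment c rho : segment_closed (cball c rho).
Proof.
move=> x u s; rewrite /cball /= => xc xuc /andP[s0 s1].
have -> : x + s *: u - c = (1 - s) *: (x - c) + s *: (x + u - c).
  by rewrite (addrAC x u) [s *: (_ + u)]scalerDr addrA -scalerDl subrK scale1r addrAC.
rewrite (le_trans (ler_normD _ _))// !normrZ !ger0_norm ?subr_ge0//.
rewrite (_ : rho = (1 - s) * rho + s * rho); last by ring.
by rewrite lerD// ler_wpM2l// subr_ge0.
Qed.

Lemma cball_step c rho x u (r : R) : cball c rho x -> enorm u <= r ->
  cball c (rho + r) (x + u).
Proof.
rewrite /cball /= => xc ur; rewrite addrAC (le_trans (ler_normD _ _))// lerD//.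
exact: le_trans (norm_le_enorm u) ur.
Qed.

Lemma cball_sub c rho r : rho <= r -> cball c rho `<=` cball c r.
Proof. by move=> rr x /= xc; exact: le_trans rr. Qed.

(** Rational points near a point of the ball, possibly on its boundary, lie in the
    ball of radius [rho + 1]. *)
Lemma ge0_on_cball c rho (phi : 'rV[R]_d -> R) : continuous phi ->
  (forall q : 'rV[rat]_d, cball c (rho + 1) (map_mx ratr q) -> 0 <= phi (map_mx ratr q)) ->
  forall x, cball c rho x -> 0 <= phi x.
Proof.
move=> cphi phiq x xc; rewrite leNgt; apply/negP => phi0.
have /nbhs_ballP[e /= e0 eN] : nbhs x [set y | phi y < 0].
  exact: (cphi x [set r : R | r < 0] (open_nbhs_nbhs (conj (@open_lt R 0) phi0))).
have e10 : 0 < Num.min e 1 by rewrite lt_min e0 ltr01.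
have [q xq] := rat_vector_dense x e10.
move: xq; rewrite lt_min => /andP[xqe xq1].
have : phi (map_mx ratr q) < 0 by apply: eN; rewrite -ball_normE.
rewrite ltNge phiq// /cball /= -(subrKA x) (le_trans (ler_normD _ _))//.
by rewrite addrC lerD// distrC ltW.
Qed.

Lemma continuous_lipschitz_gap (H : 'rV[R]_d -> R) (m : R) (y : 'rV[R]_d) :
  continuous H -> continuous (fun x => m * `|x - y| - `|H x - H y|).
Proof.
move=> cH z.
have c1 : {for z, continuous (fun x : 'rV[R]_d => x - y)}.
 by apply: continuousB; [exact: cvg_id | exact: cst_continuous].
have c2 : (fun x : 'rV[R]_d => `|x - y|) @ z --> `|z - y|.
  by apply: continuous_comp; last exact: norm_continuous.
have c3 : (fun x : 'rV[R]_d => `|H x - H y|) @ z --> `|H z - H y|.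
  apply: (@cvg_norm _ _ _ (nbhs z) _ (fun x => H x - H y)).
  apply: (@cvgB _ _ _ (nbhs z) _ H (fun=> H y)); [exact: cH|exact: cvg_cst].
apply: (@cvgB _ _ _ (nbhs z) _ (fun x => m * `|x - y|) (fun x => `|H x - H y|)); last exact: c3.
apply: (@cvgM _ _ (nbhs z) _ (fun=> m) (fun x => `|x - y|)); [exact: cvg_cst|exact: c2].
Qed.

Lemma lipschitz_from_rational c rho (h : 'rV[R]_d -> R) (m : R) : continuous h ->
  (forall p q : 'rV[rat]_d, cball c (rho + 1) (map_mx ratr p) ->
    cball c (rho + 1) (map_mx ratr q) ->
    `|h (map_mx ratr p) - h (map_mx ratr q)| <= m * `|map_mx ratr p - map_mx ratr q|) ->
  forall x y, cball c rho x -> cball c rho y -> `|h x - h y| <= m * `|x - y|.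
Proof.
move=> ch hq x y xc yc; rewrite -subr_ge0.
have key y' := @ge0_on_cball c rho _ (@continuous_lipschitz_gap h m y' ch).
apply: (key y _ x xc) => p pc.
rewrite (distrC _ y) (distrC _ (h y)); apply: (key _ _ y yc) => q qc.
by rewrite subr_ge0 hq.
Qed.

End Balls.

Section Integrability.
Context {R : realType} {dO : measure_display} {Omega : measurableType dO}.
Variable P : probability Omega R.

(** The integral of a nonnegative function is a supremum over the simple functions
    below it, so it is monotone even when [Y] is not measurable. *)
Lemma integrableR_expectation (X Y : Omega -> R) : measurable_fun setT X ->
  (forall w, `|X w| <= Y w) -> ('E_P[Y] < +oo)%E -> integrableR P X.
Proof.
move=> mX XY; rewrite unlock => Yoo; apply/integrableP; split.
  exact/measurable_EFinP.
apply: le_lt_trans Yoo; rewrite !ge0_integralTE.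
- apply: le_ereal_sup => _ [h /= hX <-]; exists h => //= w.
  by apply: (le_trans (hX w)); rewrite lee_fin.
- by move=> w; rewrite lee_fin (le_trans _ (XY w)).
- by [].
Qed.

Lemma mean_off_null (X : Omega -> R) (N : set Omega) : measurable N -> P N = 0%E ->
  integrableR P X -> mean P X = \int[P]_(w in setT `\` N) X w.
Proof.
by move=> mN N0 iX; rewrite /mean /Rintegral (negligible_integral mN).
Qed.

Lemma le_mean_ae (X Y : Omega -> R) (N : set Omega) : measurable N -> P N = 0%E ->
  integrableR P X -> integrableR P Y -> (forall w, ~ N w -> X w <= Y w) ->
  mean P X <= mean P Y.
Proof.
move=> mN N0 iX iY XY; rewrite !(mean_off_null mN N0)//.
have mD : measurable (setT `\` N) by exact: measurableD.
apply: le_Rintegral => //; try by apply: integrableS; last eassumption.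
by move=> w [_ Nw]; exact: XY.
Qed.

End Integrability.

Section RandomSmoothness.
Context {R : realType} {d : nat} {dO : measure_display} {Omega : measurableType dO}.
Variable P : probability Omega R.
Hypothesis d_gt0 : (0 < d)%N.
Context {T : ptopologicalType}.
Variables (Z : Omega -> borel T) (f : 'rV[R]_d -> T -> R).
Hypothesis Z_meas : measurable_fun setT Z.
Hypothesis f_meas : measurable_fun setT
  (fun p : borel 'rV[R]_d * borel T => f p.1 p.2).
Hypothesis C2 : forall z : T, twice_continuously_differentiable (f ^~ z).

Section Measurability.
Context {dD : measure_display} {D : measurableType dD}.
Variables (x : D -> 'rV[R]_d) (z : D -> borel T).
Hypothesis mx : forall i, measurable_fun setT (fun w => x w ord0 i).
Hypothesis mz : measurable_fun setT z.

Lemma measurable_sample_value : measurable_fun setT (fun w => f (x w) (z w)).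
Proof.
exact: (measurableT_comp f_meas (measurable_fun_pair (measurable_vector mx) mz)).
Qed.

End Measurability.

Lemma measurable_sample_derive (dD : measure_display) (D : measurableType dD)
    (x : D -> 'rV[R]_d) (z : D -> borel T) u :
  (forall i, measurable_fun setT (fun w => x w ord0 i)) -> measurable_fun setT z ->
  measurable_fun setT (fun w => 'D_u (f ^~ (z w)) (x w)).
Proof.
move=> mx mz; apply: measurable_derive => [a|w].
  apply: measurable_sample_value => // i; under eq_fun do rewrite !mxE.
  exact: measurable_funD.
by apply: diff_derivable; case: (C2 (z w)).
Qed.

Lemma measurable_sample_derive2 (dD : measure_display) (D : measurableType dD)
    (x : D -> 'rV[R]_d) (z : D -> borel T) u v :
  (forall i, measurable_fun setT (fun w => x w ord0 i)) -> measurable_fun setT z ->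
  measurable_fun setT (fun w => 'D_u ('D_v (f ^~ (z w))) (x w)).
Proof.
move=> mx mz; apply: (measurable_derive (D := fun w => 'D_v (f ^~ (z w)))) => [a|w].
  apply: measurable_sample_derive => // i; under eq_fun do rewrite !mxE.
  exact: measurable_funD.
by apply: diff_derivable; apply: C2_diff2; exact: C2.
Qed.

Let mcst (y : 'rV[R]_d) : forall i,
  measurable_fun [set: borel T] (fun=> y ord0 i).
Proof. by move=> i; exact: measurable_cst. Qed.

Lemma measurable_value (y : 'rV[R]_d) : measurable_fun [set: borel T] (f y).
Proof. exact: measurable_sample_value (mcst y) (@measurable_id _ _ _). Qed.

Lemma measurable_gradient_coord (y : 'rV[R]_d) i :
  measurable_fun [set: borel T] (fun z => gradient (f ^~ z) y ord0 i).
Proof.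
under eq_fun do rewrite mxE.
exact: (measurable_sample_derive _ (mcst y) (@measurable_id _ _ _)).
Qed.

Lemma measurable_hessian_entry (y : 'rV[R]_d) i j :
  measurable_fun [set: borel T] (fun z => hessian (f ^~ z) y i j).
Proof.
under eq_fun do rewrite hessian_entryE//.
exact: (measurable_sample_derive2 _ _ (mcst y) (@measurable_id _ _ _)).
Qed.

Variables (xs : 'rV[R]_d) (alpha : R).
Hypothesis alpha_bounds : 0 < alpha <= 1.
Hypothesis hess_int : ('E_P[fun w => opnorm (hessian (f ^~ (Z w)) xs)] < +oo)%E.
Hypothesis grad_int :
  ('E_P[fun w => (enorm (gradient (f ^~ (Z w)) xs) `^ (1 + alpha))%R] < +oo)%E.
Hypothesis hess_lip : forall K : set 'rV[R]_d, compact K ->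
  exists M : borel T -> R,
    [/\ measurable_fun setT M,
        forall z, 0 <= M z,
        ('E_P[fun w => M (Z w)] < +oo)%E
      & {ae P, forall w, forall x y : 'rV[R]_d, K x -> K y ->
          opnorm (hessian (f ^~ (Z w)) x - hessian (f ^~ (Z w)) y) <=
            M (Z w) * enorm (x - y)}].

Lemma gradient_moment i :
  integrableR P (fun w => `|gradient (f ^~ (Z w)) xs ord0 i| `^ (1 + alpha)).
Proof.
have /andP[a0 _] := alpha_bounds.
apply: integrableR_expectation grad_int => [|w].
  apply: (measurableT_comp (measurable_powR _)); apply: measurableT_comp => //.
  exact: (measurableT_comp (measurable_gradient_coord xs i)).
rewrite ger0_norm ?powR_ge0// ge0_ler_powR ?nnegrE ?addr_ge0 ?(ltW a0)//.
  exact: enorm_ge0.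
exact: coord_le_enorm.
Qed.

Lemma gradient_integrable i :
  integrableR P (fun w => gradient (f ^~ (Z w)) xs ord0 i).
Proof.
have /andP[a0 _] := alpha_bounds.
apply: (integrableR_le _ (integrableRD (integrableR_cst P 1) (gradient_moment i))) => [|w].
  exact: (measurableT_comp (measurable_gradient_coord xs i)).
set t := `|_|; have [t1|t1] := leP t 1; first by rewrite (le_trans t1)// lerDl powR_ge0.
rewrite (@le_trans _ _ (t `^ (1 + alpha)))//; last by rewrite lerDr.
by apply: le1r_powR; [exact: ltW|rewrite lerDl ltW].
Qed.

(** The Lipschitz bound on the Hessian holds almost surely for [Z], and has to be
    transferred to its copies.  Being tested on rational points, it holds outside
    of a measurable set [N] of values, which is null for the law of [Z] and hence
    for the law of every copy. *)
Lemma random_smoothness (rho : R) : 0 <= rho ->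
  exists (L : borel T -> R) (N : set (borel T)),
    [/\ measurable_fun setT L, forall z, 0 <= L z, integrableR P (L \o Z),
        measurable N /\ P (Z @^-1` N) = 0%E &
        forall z, ~ N z -> smooth_on (cball xs rho) (L z) (f ^~ z)].
Proof.
move=> rho0; have [M [mM M0 iM aeM]] := hess_lip (@cball_compact _ _ xs (rho + 1)).
pose H (z : T) := hessian (f ^~ z).
pose m z := M z * d%:R.
pose q2 (q : 'rV[rat]_d) : 'rV[R]_d := map_mx ratr q.
pose bad (pq : 'rV[rat]_d * 'rV[rat]_d * ('I_d * 'I_d)) : set (borel T) :=
  [set z | m z * `|q2 pq.1.1 - q2 pq.1.2| <
    `|H z (q2 pq.1.1) pq.2.1 pq.2.2 - H z (q2 pq.1.2) pq.2.1 pq.2.2|].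
pose inside (pq : 'rV[rat]_d * 'rV[rat]_d * ('I_d * 'I_d)) :=
  cball xs (rho + 1) (q2 pq.1.1) /\ cball xs (rho + 1) (q2 pq.1.2).
pose N := \bigcup_(pq in setT) (if `[< inside pq >] then bad pq else set0).
have mN : measurable N.
  apply: countable_bigcupT_measurable => // pq; case: ifP => // _.
  rewrite /bad [X in measurable X](_ : _ = ~` [set z |
    `|H z (q2 pq.1.1) pq.2.1 pq.2.2 - H z (q2 pq.1.2) pq.2.1 pq.2.2| <=
    m z * `|q2 pq.1.1 - q2 pq.1.2| ]); last first.
    by apply/seteqP; split => z /=;
      [move=> h /(lt_le_trans h); rewrite ltxx|move/negP; rewrite -ltNge].
  apply: measurableC; apply: measurable_le_set; last first.
    by apply: measurable_funM => //; exact: measurable_funM.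
  by apply: measurableT_comp => //; apply: measurable_funB; exact: measurable_hessian_entry.
have ZN : measurable (Z @^-1` N) by rewrite -[X in measurable X]setTI; exact: Z_meas.
have PN : P (Z @^-1` N) = 0%E.
  apply: measure_negligible => //; apply: negligibleS aeM => w /= [pq _].
  case: ifPn => [/asboolP[p1 p2] + h|_ []].
  rewrite /bad /= ltNge => /negP; apply.
  rewrite [X in `|X|](_ : _ =
    (H (Z w) (q2 pq.1.1) - H (Z w) (q2 pq.1.2)) pq.2.1 pq.2.2); last first.
    by rewrite [RHS]mxE [X in _ = _ + X]mxE.
  apply: (le_trans (entry_le_opnorm _ _ _)); apply: (le_trans (h _ _ p1 p2)).
  by rewrite /m -mulrA ler_wpM2l// enorm_le_norm.
pose a (z : borel T) : R := \sum_i `|gradient (f ^~ z) xs ord0 i|.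
pose b (z : borel T) : R := \sum_i \sum_j `|H z xs i j|.
pose r := d%:R * rho + 1.
pose L (z : borel T) : R := d%:R * a z + d%:R ^+ 2 * (b z + m z * r) * r.
have m0 z : 0 <= m z by rewrite mulr_ge0.
have a0 z : 0 <= a z by apply: sumr_ge0.
have b0 z : 0 <= b z by do 2![apply: sumr_ge0 => ? _].
have r0 : 0 <= r by rewrite addr_ge0// mulr_ge0.
have mm : measurable_fun setT m by exact: measurable_funM.
have iZ (g : borel T -> R) : measurable_fun setT g -> measurable_fun setT (g \o Z).
  by move=> mg; exact: measurableT_comp.
have ia : integrableR P (a \o Z).
  rewrite /a; apply: (integrableR_sum (X := fun i w => `|gradient (f ^~ (Z w)) xs ord0 i|)) => i.
  exact/integrableR_norm/gradient_integrable.
have ib : integrableR P (b \o Z).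
  apply: (integrableR_sum (X := fun i w => \sum_j `|H (Z w) xs i j|)) => i.
  apply: (integrableR_sum (X := fun j w => `|H (Z w) xs i j|)) => j.
  apply: integrableR_norm; apply: integrableR_expectation hess_int => [|w].
    exact: (iZ (fun z => H z xs i j) (measurable_hessian_entry xs i j)).
  exact: entry_le_opnorm.
have im : integrableR P (m \o Z).
  rewrite /m; have : integrableR P (fun w => d%:R * M (Z w)).
    apply: integrableRZ; apply: integrableR_expectation iM => [|w]; first exact: iZ.
    by rewrite ger0_norm.
  by congr integrableR; apply/funext => w /=; rewrite mulrC.
have iL : integrableR P (L \o Z).
  have := integrableRD (integrableRZ d%:R ia)
    (integrableRZ (d%:R ^+ 2 * r) (integrableRD ib (integrableRZ r im))).
  by congr integrableR; apply/funext => w; rewrite /L /=; ring.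
have mL : measurable_fun setT L.
  apply: measurable_funD.
    apply: measurable_funM => //; apply: measurable_sum => i; apply: measurableT_comp => //.
    exact: measurable_gradient_coord.
  apply: measurable_funM => //; apply: measurable_funM => //; apply: measurable_funD.
    apply: measurable_sum => i; apply: measurable_sum => j; apply: measurableT_comp => //.
    exact: measurable_hessian_entry.
  exact: measurable_funM.
exists L, N; split => // [z|z Nz].
  by rewrite addr_ge0 ?mulr_ge0 ?addr_ge0 ?mulr_ge0 ?exprn_ge0.
have cH i j : continuous (fun x => H z x i j : R).
  have [_ _ cz] := C2 z.
  move=> x; apply: (@continuous_comp _ _ _ (H z) (fun A : 'M[R]_d => A i j : R)).
    exact: cz.
  exact: coord_continuous.
apply: smooth_from_entries => //.
- move=> i; rewrite /a (bigD1 i)//= lerDl; exact: sumr_ge0.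
- move=> i j; rewrite /b (bigD1 i)//= (bigD1 j)//= -addrA lerDl.
  by rewrite addr_ge0//; do ?[apply: sumr_ge0 => ? _].
move=> x y i j xc yc.
suff h : `|H z x i j - H z y i j| <= m z * `|x - y|.
  by apply: (le_trans h); rewrite ler_wpM2l// norm_le_enorm.
have key := @lipschitz_from_rational _ _ xs rho (fun x => H z x i j : R) (m z) (cH i j).
apply: (key _ x y xc yc) => p q pc qc.
rewrite leNgt; apply/negP => bd; apply: Nz.
exists (p, q, (i, j)) => //; case: ifPn => // /asboolP; apply.
by split.
Qed.

End RandomSmoothness.

(** * Averages of smooth functions *)

Section Averages.
Context {R : realType} {d : nat}.
Implicit Types (K : set 'rV[R]_d) (u x : 'rV[R]_d).

Lemma smooth_on_le K (L L' : R) g : L <= L' -> smooth_on K L g -> smooth_on K L' g.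
Proof.
move=> LL' [dg d2g gg hg lg]; split => //.
- by move=> x u Kx; apply: (le_trans (gg _ _ Kx)); rewrite ler_wpM2r ?enorm_ge0.
- by move=> x u Kx; apply: (le_trans (hg _ _ Kx)); rewrite ler_wpM2r ?sqr_ge0.
- move=> x y u Kx Ky; apply: (le_trans (lg _ _ _ Kx Ky)).
  by rewrite !ler_wpM2r ?sqr_ge0 ?enorm_ge0.
Qed.

Definition avg (n : nat) (g : 'I_n -> 'rV[R]_d -> R) x : R := (\sum_(i < n) g i x) / n%:R.

Lemma avgE n (g : 'I_n -> 'rV[R]_d -> R) : avg g = n%:R^-1 \*: (\sum_(i < n) g i).
Proof. by apply/funext => x; rewrite /avg mulrC /= fct_sumE. Qed.

Lemma differentiable_avg n (g : 'I_n -> 'rV[R]_d -> R) x :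
  (forall i, differentiable (g i) x) -> differentiable (avg g) x.
Proof. by move=> dg; rewrite avgE; apply: differentiableZ; exact: differentiable_sum. Qed.

Lemma derive_avg n (g : 'I_n -> 'rV[R]_d -> R) u :
  (forall i x, differentiable (g i) x) ->
  'D_u (avg g) = avg (fun i => 'D_u (g i)).
Proof.
move=> dg; apply/funext => x; rewrite avgE deriveZ; last first.
  by apply: diff_derivable; apply: differentiable_sum => i; exact: dg.
rewrite derive_sum; last by move=> i; apply: diff_derivable; exact: dg.
by rewrite /avg mulrC.
Qed.

Lemma ler_avg n (a b : 'I_n -> R) (t : R) : 0 <= t -> (forall i, `|a i| <= b i * t) ->
  `|(\sum_(i < n) a i) / n%:R| <= (\sum_(i < n) b i) / n%:R * t.
Proof.
move=> t0 ab; rewrite normrM mulrAC [X in _ * X]ger0_norm ?invr_ge0//.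
rewrite ler_wpM2r ?invr_ge0// mulr_suml (le_trans (ler_norm_sum _ _ _))//.
by apply: ler_sum => i _.
Qed.

Lemma smooth_on_avg K n (g : 'I_n -> 'rV[R]_d -> R) (L : 'I_n -> R) :
  (forall i, smooth_on K (L i) (g i)) -> smooth_on K ((\sum_(i < n) L i) / n%:R) (avg g).
Proof.
move=> sg.
have dg i x := smooth_diff (sg i) x.
have d2g u i x := smooth_diff2 (sg i) u x.
have D1 u := derive_avg u dg.
have D1x u x : 'D_u (avg g) x = avg (fun i => 'D_u (g i)) x.
  exact: (congr1 (fun k => k x) (D1 u)).
have D2 u x : 'D_u ('D_u (avg g)) x = avg (fun i => 'D_u ('D_u (g i))) x.
  by rewrite D1; exact: (congr1 (fun k => k x) (derive_avg u (d2g u))).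
split.
- by move=> x; apply: differentiable_avg.
- by move=> u x; rewrite (D1 u); apply: differentiable_avg.
- move=> x u Kx; rewrite D1x; apply: ler_avg => [|i]; first exact: enorm_ge0.
  exact: smooth_grad.
- move=> x u Kx; rewrite D2; apply: ler_avg => [|i]; first exact: sqr_ge0.
  exact: smooth_hess.
- move=> x y u Kx Ky; rewrite !D2 /avg -mulrBl -sumrB -mulrA.
  apply: ler_avg => [|i]; first by rewrite mulr_ge0 ?sqr_ge0 ?enorm_ge0.
  by rewrite mulrA; exact: smooth_lip.
Qed.

Lemma gradient_avg n (g : 'I_n -> 'rV[R]_d -> R) x j :
  (forall i x, differentiable (g i) x) ->
  gradient (avg g) x ord0 j = (\sum_(i < n) gradient (g i) x ord0 j) / n%:R.
Proof.
move=> dg; rewrite mxE.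
rewrite (congr1 (fun k => k x) (derive_avg _ dg)) /avg; congr (_ / _).
by apply: eq_bigr => i _; rewrite mxE.
Qed.

Lemma smooth_gradient_le K L g x : 0 <= L -> smooth_on K L g -> K x ->
  enorm (gradient g x) <= L.
Proof.
move=> L0 sg Kx; have := smooth_grad sg (gradient g x) Kx.
rewrite derive_dotr; last exact: smooth_diff sg _.
rewrite -enorm_sqr ger0_norm ?sqr_ge0// expr2.
have [->//|g0] := eqVneq (enorm (gradient g x)) 0.
by rewrite ler_pM2r// lt_neqAle eq_sym g0 enorm_ge0.
Qed.

End Averages.

(** * From uniform closeness to the error of gradient descent *)

Section GoodEvent.
Context {R : realType} {d : nat}.
Variables (g F : 'rV[R]_d -> R) (xs x0 : 'rV[R]_d) (rho C0 C2 c e h beta : R) (J : nat).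
Hypotheses (rho_ge0 : 0 <= rho) (C0_gt0 : 0 < C0) (C2_gt0 : 0 < C2) (c_gt0 : 0 < c).
Let K1 := cball xs (rho + C0).
Let K2 := cball xs (rho + C0 + 1).
Hypothesis smooth0 : smooth_on (cball xs rho) C0 g.
Hypothesis smooth2 : smooth_on K2 C2 g.
Hypothesis midpoint : forall y z, K2 y -> K2 z ->
  F (2^-1 *: (y + z)) <= 2^-1 * F y + 2^-1 * F z - c / 8 * enorm (y - z) ^+ 2.
Hypothesis close : forall y, K2 y -> `|g y - F y| <= e.
Hypothesis level : forall x, F x <= F x0 + 1 -> cball xs rho x.
Hypotheses (h_gt0 : 0 < h) (h_le1 : h <= 1) (C2h : C2 * h <= c / 4).
Hypotheses (e_le : 16 * e <= c * h ^+ 2) (e_half : e <= 2^-1).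
Hypotheses (beta01 : 0 < beta < 1) (betaJ : beta ^+ J * C2 <= 1).

Let K12 : K1 `<=` K2. Proof. by apply: cball_sub; rewrite lerDl. Qed.
Let K01 : cball xs rho `<=` K1. Proof. by apply: cball_sub; rewrite lerDl ltW. Qed.
Let K0x0 : cball xs rho x0. Proof. by apply: level; rewrite lerDl. Qed.
Let dg x : differentiable g x. Proof. exact: smooth_diff smooth2 x. Qed.

(** [close_to_strongly_convex] makes [g] strongly convex on [K1].  The iterates stay
    in the ball of radius [rho]: a step of size at most [1] along a gradient bounded
    by [C0] ends in [K1], where [g] is [e]-close to [F], so that a point with
    [g x <= g x0] belongs to the sublevel set of [level]. *)
Lemma good_event_bound cg ce B : (0 < ce)%N -> (0 < B)%N ->
  let err := enorm (gd_point (gd_run g cg ce 0 beta x0 B) - xs) in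
  c / 4 * err ^+ 2 <= C2 * enorm (x0 - xs) * (J.+1 * ce + cg)%N%:R /
      (Num.min 3^-1 (c / 2 * beta ^+ J) * B%:R) + enorm (gradient g xs) * err.
Proof.
move=> ce0 B0; cbv zeta.
have K1xs : K1 xs by rewrite /K1 /cball /= subrr normr0 addr_ge0// ltW.
have convex x u : K1 x -> K1 (x + u) ->
    g x + dotr (gradient g x) u + c / 2 / 2 * enorm u ^+ 2 <= g (x + u).
  move=> K1x K1xu; rewrite -derive_dotr// mulrAC.
  apply: taylor_ge => //; first exact: smooth_diff2 smooth2 u.
  move=> s s01; have K1s := cball_segment K1x K1xu s01.
  have Kw w : enorm w = h -> K2 (x + s *: u + w).
    by move=> wh; rewrite /K2; apply: cball_step => //; rewrite wh.
  exact: (close_to_strongly_convex u smooth2 (@cball_segment _ _ xs _) c_gt0 midpoint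
    close h_gt0 C2h e_le Kw (K12 K1s)).
have descent x u : K1 x -> K1 (x + u) ->
    g (x + u) <= g x + dotr (gradient g x) u + C2 / 2 * enorm u ^+ 2.
  move=> K1x K1xu; rewrite -derive_dotr//.
  by apply: (smooth_descent smooth2); [exact: cball_segment|exact: K12|exact: K12].
have trap x v : cball xs rho x -> 0 < v <= 1 -> K1 (x - v *: gradient g x).
  move=> K0x /andP[v0 v1]; apply: cball_step => //.
  rewrite enormN enormZ gtr0_norm// (le_trans _ (smooth_gradient_le (ltW C0_gt0) smooth0 K0x))//.
  by rewrite ler_piMl ?enorm_ge0.
have lev x : K1 x -> g x <= g x0 -> cball xs rho x.
  move=> K1x gx; apply: level.
  have := close (K12 K1x); have := close (K12 (K01 K0x0)).
  rewrite !ler_norml => /andP[_ h1] /andP[h2 _].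
  move: h1 h2 gx e_half; move: (F x) (F x0) (g x) (g x0) => a b k l ? ? ? ?; lra.
have c20 : 0 < c / 2 by rewrite divr_gt0.
have := @gd_run_bound R d g (cball xs rho) K1 x0 xs (c / 2) C2 beta J cg ce c20
  (ltW C2_gt0) beta01 betaJ ce0 convex descent trap lev K01 K1xs K0x0 B B0.
cbv zeta; set err := enorm _; set gam := enorm _ * err; set ka := (J.+1 * ce + cg)%N.
move=> bnd; rewrite (_ : c / 4 = c / 2 / 2); last by lra.
apply: (le_trans bnd); rewrite lerD2r.
have m0 : 0 < Num.min 3^-1 (c / 2 * beta ^+ J).
  have /andP[b0 _] := beta01.
  by rewrite lt_min invr_gt0 ltr0n/= mulr_gt0// exprn_gt0.
rewrite ler_wpM2r ?invr_ge0 ?mulr_ge0 ?(ltW m0)// ler_wpM2r// ge_max.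
rewrite mulr_ge0 ?enorm_ge0 ?(ltW C2_gt0)//=.
have := @smooth_lipschitz R d K2 C2 g xs (x0 - xs) smooth2 (@cball_segment _ _ _ _) (K12 K1xs).
by rewrite [xs + _]addrC subrK => /(_ (K12 (K01 K0x0))) /(le_trans (ler_norm _)).
Qed.

End GoodEvent.

(** * Regularity of the risk *)

Section Nets.
Context {R : realType} {d : nat}.

Lemma cball_net (c : 'rV[R]_d) (rho delta : R) : 0 < delta ->
  exists s : seq 'rV[R]_d, (forall p, p \in s -> cball c rho p) /\
    forall x, cball c rho x -> exists2 p, p \in s & `|x - p| <= delta.
Proof.
move=> d0; have := @cball_compact R d c rho; rewrite compact_cover => cov.
have [||D Dsub Dcov] := cov _ (cball c rho) (fun p => ball p delta).
- by move=> p _; exact: ball_open.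
- by move=> x xc; exists x => //; exact: ballxx.
exists (enum_fset D); split=> [p pD|x xc]; first by have := Dsub p pD; rewrite inE.
have [p /= pD] := Dcov x xc.
by rewrite -ball_normE /= => px; exists p => //; rewrite distrC ltW.
Qed.

(** Both functions are Lipschitz, so they vary little within [delta] of the net. *)
Lemma close_from_net (g F : 'rV[R]_d -> R) (c : 'rV[R]_d) (s : seq 'rV[R]_d)
    (rho delta e L L' : R) :
  (forall p, p \in s -> cball c rho p) ->
  (forall x, cball c rho x -> exists2 p, p \in s & `|x - p| <= delta) ->
  smooth_on (cball c rho) L g -> 0 <= L + L' ->
  (forall x y, cball c rho x -> cball c rho y -> `|F x - F y| <= L' * enorm (x - y)) ->
  (L + L') * (d%:R * delta) <= e / 2 ->
  (forall p, p \in s -> `|g p - F p| <= e / 2) ->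
  forall x, cball c rho x -> `|g x - F x| <= e.
Proof.
move=> sc net sg LL0 lF small gF x xc; have [p ps xp] := net x xc.
have pc := sc p ps.
have := smooth_lipschitz sg (@cball_segment _ _ c rho) pc (u := x - p).
rewrite [p + _]addrC subrK => /(_ xc) h1.
have h2 := lF _ _ xc pc; have h3 := gF p ps.
have h4 : (L + L') * enorm (x - p) <= e / 2.
  apply: le_trans small; rewrite ler_wpM2l// (le_trans (enorm_le_norm _))//.
  by rewrite ler_wpM2l.
move: h1 h2 h3 h4; rewrite !ler_norml.
move: (g x) (g p) (F x) (F p) (enorm _) => a b k l t /andP[? ?] /andP[? ?] /andP[? ?] ?.
by apply/andP; split; lra.
Qed.

End Nets.

Section Risk.
Context {R : realType} {d : nat} {dO : measure_display} {Omega : measurableType dO}.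
Variable P : probability Omega R.
Context {T : ptopologicalType}.
Variables (Z : Omega -> borel T) (f : 'rV[R]_d -> T -> R) (xs : 'rV[R]_d).
Hypothesis Z_meas : measurable_fun setT Z.
Hypothesis f_int : forall x : 'rV[R]_d, P.-integrable setT (fun w => (f x (Z w))%:E).

Let F := risk P f Z.

Lemma riskE x : F x = mean P (fun w => f x (Z w)).
Proof. by rewrite /F /risk unlock. Qed.

Variables (rho : R) (L : borel T -> R) (N : set (borel T)).
Hypothesis L_int : integrableR P (L \o Z).
Hypotheses (mN : measurable N) (PN : P (Z @^-1` N) = 0%E).
Hypothesis smoothL : forall z, ~ N z -> smooth_on (cball xs rho) (L z) (f ^~ z).

Let mZN : measurable (Z @^-1` N).
Proof. by rewrite -[X in measurable X]setTI; exact: Z_meas. Qed.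

Lemma risk_lipschitz x y : cball xs rho x -> cball xs rho y ->
  `|F x - F y| <= mean P (L \o Z) * enorm (x - y).
Proof.
move=> xc yc; rewrite !riskE -meanB; [|exact: f_int|exact: f_int].
set e := enorm _.
have iXY : integrableR P (fun w => f x (Z w) - f y (Z w)) by apply: integrableRB; exact: f_int.
have iLe : integrableR P (fun w => e * L (Z w)) by apply: integrableRZ.
have XY w : ~ (Z @^-1` N) w -> `|f x (Z w) - f y (Z w)| <= e * L (Z w).
  move=> Nw; have := smooth_lipschitz (smoothL Nw) (@cball_segment _ _ xs rho) yc (u := x - y).
  by rewrite [y + _]addrC subrK mulrC; apply.
apply: (le_trans (le_norm_mean iXY)); rewrite mulrC -meanZ//.
by apply: (le_mean_ae mZN PN) => //; exact: integrableR_norm.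
Qed.

(** Integrating the second order expansion of [f] at [xs] gives
    [0 <= F (xs + s *: u) - F xs <= s * m + O(s ^+ 2)] for all small [s] of either
    sign, where [m] is the mean derivative; this avoids differentiating [F]. *)
Lemma mean_gradient0 i : 0 < rho -> (forall x, F xs <= F x) ->
  integrableR P (fun w => gradient (f ^~ (Z w)) xs ord0 i) ->
  mean P (fun w => gradient (f ^~ (Z w)) xs ord0 i) = 0.
Proof.
move=> rho0 Fmin iG; set m := mean P _.
set u : 'rV[R]_d := delta_mx ord0 i.
have L0 w : ~ N (Z w) -> 0 <= L (Z w).
  move=> Nw; have := smooth_hess (smoothL Nw) u (x := xs).
  rewrite /cball /= subrr normr0 (ltW rho0) => /(_ isT).
  by rewrite enorm_delta expr1n mulr1; exact: le_trans.
have mL0 : 0 <= mean P (L \o Z).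
  rewrite -(mean_cst P 0); apply: (le_mean_ae mZN PN) => //; exact: integrableR_cst.
have step (s : R) : `|s| <= rho -> 0 <= s * m + mean P (L \o Z) / 2 * s ^+ 2.
  move=> srho.
  have su : enorm (s *: u) = `|s| by rewrite enormZ enorm_delta mulr1.
  have xc : cball xs rho xs by rewrite /cball /= subrr normr0 ltW.
  have yc : cball xs rho (xs + s *: u).
    by rewrite /cball /= addrAC subrr add0r (le_trans (norm_le_enorm _))// su.
  have : 0 <= F (xs + s *: u) - F xs by rewrite subr_ge0.
  rewrite !riskE -meanB; [|exact: f_int|exact: f_int].
  move/le_trans; apply.
  rewrite /m -meanZ// (_ : _ / 2 * s ^+ 2 = s ^+ 2 / 2 * mean P (L \o Z)); last by ring.
  rewrite -meanZ// -meanD; [|exact: integrableRZ|exact: integrableRZ].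
  apply: (le_mean_ae mZN PN).
  - by apply: integrableRB; exact: f_int.
  - by apply: integrableRD; exact: integrableRZ.
  move=> w Nw; have sw := smoothL Nw.
  have := smooth_descent sw (@cball_segment _ _ xs rho) xc yc.
  rewrite su real_normK ?num_real// derive_dotr; last exact: smooth_diff sw _.
  rewrite dotrZr dotrC dotr_delta /=; lra.
set l := mean P (L \o Z) in mL0 step.
have l1 : 0 < l + 1 by rewrite ltr_wpDl.
have small (b : R) : 0 < b -> exists s, [/\ 0 < s, s <= rho & s * (l + 1) <= b].
  move=> b0; exists (Num.min rho (b / (l + 1))).
  split; first by rewrite lt_min rho0 divr_gt0.
    by rewrite ge_min lexx.
  by rewrite -ler_pdivlMr// ge_min lexx orbT.
have absurd (s b : R) : 0 < s -> s * (l + 1) <= b -> 0 <= - s * b + l / 2 * s ^+ 2 -> False.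
  move=> s0 sb h; have := ler_wpM2l (ltW s0) sb.
  have := mulr_ge0 mL0 (sqr_ge0 s); have : 0 < s ^+ 2 by rewrite exprn_gt0.
  move: h; rewrite expr2; lra.
have [m0|m0|//] := ltgtP m 0; exfalso.
- have [|s [s0 sr sl]] := small (- m); first by rewrite oppr_gt0.
  by apply: (absurd s (- m)) => //; rewrite mulrNN; apply: step; rewrite gtr0_norm.
- have [s [s0 sr sl]] := small m m0.
  apply: (absurd s m) => //; have := step (- s); rewrite normrN sqrrN gtr0_norm//.
  by apply.
Qed.

End Risk.

(** Local strong convexity gives [F xs + c / 4 <= F p] at distance [1] of [xs], and
    convexity makes [F] grow at least linearly beyond. *)
Lemma sublevel_bounded (R : realType) (d : nat) (F : 'rV[R]_d -> R) (xs : 'rV[R]_d) (a : R) :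
  strictly_convex F -> locally_strongly_convex F -> (forall x, F xs <= F x) ->
  exists2 rho, 0 <= rho & forall x, F x <= a -> cball xs rho x.
Proof.
move=> sconv lconv Fmin.
have [c c0 cF] := lconv _ (@cball_compact R d xs 1).
exists (Num.max 1 (4 * (a - F xs) / c)); first by rewrite le_max ler01.
move=> x Fxa; rewrite /cball /= leNgt gt_max; apply/negP => /andP[x1 xa].
set r := `|x - xs| in x1 xa.
have r0 : 0 < r by rewrite (lt_trans _ x1).
(* [p] is the point of the segment from [xs] to [x] at distance [1] of [xs]. *)
pose p := r^-1 *: x + (1 - r^-1) *: xs.
have r1 : r^-1 < 1 by rewrite invf_lt1.
have pE : p - xs = r^-1 *: (x - xs).
  by rewrite /p scalerBl scale1r scalerBr (addrC xs) addrA addrK.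
have np : `|p - xs| = 1 by rewrite pE normrZ gtr0_norm ?invr_gt0// mulVf// gt_eqF.
have xxs : x != xs.
  by apply: contraTneq r0 => xE; rewrite /r xE subrr normr0 ltxx.
have h1 : F p < r^-1 * F x + (1 - r^-1) * F xs by apply: sconv => //; rewrite invr_gt0.
have := cF 2^-1 p xs; rewrite /cball /= np subrr normr0 ler01 lexx.
rewrite (_ : 0 <= 2^-1 <= 1); last by rewrite invr_ge0 ler0n invf_le1// ler1n.
move=> /(_ isT isT isT); have := Fmin (2^-1 *: p + (1 - 2^-1) *: xs).
have e1 : 1 <= enorm (p - xs) ^+ 2.
  by rewrite -[leLHS](expr1n _ 2) lerXn2r ?nnegrE ?enorm_ge0// -np norm_le_enorm.
move=> h2 h3.
have h4 : F xs + c / 4 <= F p.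
  have : c * 1 <= c * enorm (p - xs) ^+ 2 by rewrite ler_pM2l.
  move: h2 h3; move: (F p) (F xs) (F _) (enorm _ ^+ 2) => A B C E h2 h3 h5; lra.
have h5 : r * (c / 4) < F x - F xs.
  have : F xs + c / 4 < r^-1 * F x + (1 - r^-1) * F xs by exact: le_lt_trans h1.
  have -> : r^-1 * F x + (1 - r^-1) * F xs = F xs + (F x - F xs) / r.
    by ring.
  by rewrite ltrD2l ltr_pdivlMr// mulrC.
move: xa; rewrite ltr_pdivrMr//; move: h5 Fxa; move: (F x) (F xs) => A B; lra.
Qed.

(** * The rate of convergence *)

Lemma limn_esup_le_near (R : realType) (u : nat -> \bar R) (c : \bar R) :
  (\forall n \near \oo, (u n <= c)%E) -> (limn_esup u <= c)%E.
Proof.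
move=> uc; apply: (@le_trans _ _ (ereal_sup [set u n | n in [set n | (u n <= c)%E]])).
  by apply: ereal_inf_lbound; exists [set n | (u n <= c)%E].
by apply: ge_ereal_sup => _ [n /= un <-].
Qed.

Section Rate.
Context {R : realType}.
Variables (alpha : R) (n : nat -> nat).
Hypothesis alpha_bounds : 0 < alpha <= 1.

Lemma rate_gt0 B : (0 < n B)%N -> 0 < rate alpha n B.
Proof. by move=> nB; rewrite /rate lt_max powR_gt0 ?orbT// ltr0n. Qed.

Lemma ratio_le_rate B : (n B)%:R / B%:R <= rate alpha n B ^+ 2.
Proof.
have nB0 : 0 <= (n B)%:R / B%:R :> R by rewrite divr_ge0.
rewrite -[leLHS]sqr_sqrtr// lerXn2r ?nnegrE ?sqrtr_ge0//; last by rewrite /rate le_max lexx.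
by rewrite /rate le_max sqrtr_ge0.
Qed.

(** The two terms of the rate balance when [n B] is [B `^ q]; whichever side of
    this threshold [n B] is on, one of them is at least [B `^ - gamma]. *)
Lemma rate_lower_bound B : (0 < B)%N -> (0 < n B)%N ->
  1 <= B%:R `^ (alpha / (1 + 3 * alpha)) * rate alpha n B.
Proof.
move=> B0 nB0; have /andP[a0 _] := alpha_bounds.
have BR : (0 : R) < B%:R by rewrite ltr0n.
have nR : (0 : R) < (n B)%:R by rewrite ltr0n.
have p1 : 0 < 1 + alpha by rewrite addr_gt0.
have p3 : 0 < 1 + 3 * alpha by rewrite addr_gt0// mulr_gt0.
set gamma := alpha / (1 + 3 * alpha); pose q := (1 + alpha) / (1 + 3 * alpha).
have q0 : 0 <= q by rewrite divr_ge0// ltW.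
have BN : B%:R != 0 :> R by rewrite gt_eqF.
have imp : forall a b : R, (a + b == 0) ==> (B%:R != 0 :> R) by move=> *; apply/implyP.
rewrite -(@ler_pM2l _ (B%:R `^ (- gamma))) ?powR_gt0// mulr1 mulrA -powRD//.
rewrite addNr powRr0 mul1r /rate le_max; apply/orP.
have [nq|nq] := leP (n B)%:R (B%:R `^ q : R).
  right; rewrite (_ : - gamma = q * - (alpha / (1 + alpha))); last first.
    by rewrite /gamma /q; field; rewrite !gt_eqF.
  rewrite powRrM !powRN lef_pV2 ?posrE ?powR_gt0//.
  by rewrite ge0_ler_powR ?nnegrE ?powR_ge0// divr_ge0// ltW.
left; rewrite -[leLHS]ger0_norm ?powR_ge0// -sqrtr_sqr ler_sqrt; last by rewrite divr_ge0.
rewrite -powR_mulrn ?powR_ge0// -powRrM (_ : - gamma * 2%:R = q - 1); last first.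
  by rewrite /gamma /q; field; rewrite gt_eqF.
rewrite powRD// powR_inv1 ?(ltW BR)// ler_wpM2r ?invr_ge0 ?(ltW BR)//.
exact: ltW.
Qed.

End Rate.

(** Either [e <= r], or [r ^+ 2 <= r * e] and the inequality can be divided by [e]. *)
Lemma quadratic_bound (R : realType) (c a b r e : R) : 0 < c -> 0 <= a -> 0 <= b ->
  0 < r -> 0 <= e -> c / 4 * e ^+ 2 <= a * r ^+ 2 + b * r * e ->
  e <= Num.max 1 (4 * (a + b) / c) * r.
Proof.
move=> c0 a0 b0 r0 e0 h; have [er|re] := leP e r.
  by rewrite (le_trans er)// ler_peMl ?(ltW r0)// le_max lexx.
rewrite (@le_trans _ _ (4 * (a + b) / c * r))//; last first.
  by rewrite ler_wpM2r ?(ltW r0)// le_max lexx orbT.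
have e0' := lt_trans r0 re.
have ar : a * r ^+ 2 <= a * r * e.
  by rewrite expr2 mulrA ler_wpM2l ?mulr_ge0 ?(ltW r0)// ltW.
rewrite mulrAC ler_pdivlMr// -(ler_pM2r e0').
by move: h ar; rewrite expr2; lra.
Qed.

Lemma exists_small_power (R : realType) (beta C : R) : 0 < beta < 1 ->
  exists J : nat, beta ^+ J * C <= 1.
Proof.
move=> /andP[b0 b1]; have [C0|C0] := leP C 0.
  by exists 0%N; rewrite expr0 mul1r (le_trans C0).
have nb : `|beta| < 1 by rewrite gtr0_norm.
have /cvgrPdist_lt/(_ C^-1)[|J _ JP] := cvg_expr nb; first by rewrite invr_gt0.
exists J; have := JP J (leqnn J); rewrite /= sub0r normrN gtr0_norm ?exprn_gt0//.
by move=> /ltW h; rewrite -ler_pdivlMr// div1r.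
Qed.

(** * The error bound in probability *)

Section ErrorMeasurability.
Context {R : realType} {d : nat} {dO : measure_display} {Omega : measurableType dO}.
Context {T : ptopologicalType}.
Variables (Zs : nat -> Omega -> borel T) (f : 'rV[R]_d -> T -> R).
Hypothesis Zs_meas : forall i, measurable_fun setT (Zs i).
Hypothesis f_meas : measurable_fun setT
  (fun p : borel 'rV[R]_d * borel T => f p.1 p.2).
Hypothesis C2 : forall z : T, twice_continuously_differentiable (f ^~ z).

Lemma measurable_gd_error (Cgrad Ceval n B : nat) (x0 xs : 'rV[R]_d) (beta : R) :
  (0 < n * Ceval)%N ->
  measurable_fun setT (fun w => enorm ((GD f Cgrad Ceval (Zs ^~ w) x0 n B 0 beta).1 - xs)).
Proof.
move=> ce0; apply: measurable_enorm => i; under eq_fun do rewrite !mxE.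
apply: measurable_funB => //; rewrite /GD /=.
apply: (measurable_gd_point (F := fun w => empirical_risk f (Zs ^~ w) n)) => // x mx.
  apply: measurable_funM => //; apply: measurable_sum => j.
  exact: measurable_sample_value.
move=> j.
have E w : gradient (empirical_risk f (Zs ^~ w) n) (x w) ord0 j =
    (\sum_(k < n) 'D_(delta_mx ord0 j) (f ^~ (Zs k w)) (x w)) / n%:R.
  rewrite (@gradient_avg R d n (fun k => f ^~ (Zs k w))); last first.
    by move=> k y; case: (C2 (Zs k w)).
  by congr (_ / _); apply: eq_bigr => k _; rewrite mxE.
under eq_fun do rewrite E.
apply: measurable_funM => //; apply: measurable_sum => k.
exact: measurable_sample_derive.
Qed.

End ErrorMeasurability.


Section Main.
Context (R : realType) (d : nat) (d_gt0 : (0 < d)%N)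
    (dO : measure_display) (Omega : measurableType dO) (P : probability Omega R)
    (T : ptopologicalType)
    (Z : Omega -> borel T) (Z_meas : measurable_fun setT Z)
    (Zs : nat -> Omega -> borel T) (Zs_iid : iid_copies P Z Zs)
    (f : 'rV[R]_d -> T -> R)
    (f_meas : measurable_fun setT
      (fun p : borel 'rV[R]_d * borel T => f p.1 p.2))
    (f_int : forall x : 'rV[R]_d, P.-integrable setT (fun w => (f x (Z w))%:E))
    (F_sconvex : strictly_convex (risk P f Z))
    (xs : 'rV[R]_d) (xs_min : forall x : 'rV[R]_d, risk P f Z xs <= risk P f Z x)
    (A1 : locally_strongly_convex (risk P f Z))
    (alpha : R) (alpha_bounds : 0 < alpha <= 1)
    (A2_C2 : forall z : T, twice_continuously_differentiable (f ^~ z))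
    (A2_hess : ('E_P[fun w => opnorm (hessian (f ^~ (Z w)) xs)] < +oo)%E)
    (A2_grad :
      ('E_P[fun w => (enorm (gradient (f ^~ (Z w)) xs) `^ (1 + alpha))%R] < +oo)%E)
    (A2_lip : forall K : set 'rV[R]_d, compact K ->
      exists M : borel T -> R,
        [/\ measurable_fun setT M,
            forall z, 0 <= M z,
            ('E_P[fun w => M (Z w)] < +oo)%E
          & {ae P, forall w, forall x y : 'rV[R]_d, K x -> K y ->
              opnorm (hessian (f ^~ (Z w)) x - hessian (f ^~ (Z w)) y) <=
                M (Z w) * enorm (x - y)}])
    (Cgrad Ceval : nat) (Ceval_gt0 : (0 < Ceval)%N)
    (x0 : 'rV[R]_d) (beta : R) (beta_bounds : 0 < beta < 1).

Let F := risk P f Z.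
Let mZs i : measurable_fun setT (Zs i). Proof. by case: Zs_iid. Qed.

(** The smoothness constant of the empirical risk is the empirical mean of those of
    the [f ^~ z], which Markov's inequality bounds uniformly in the sample size. *)
Lemma empirical_smoothness rho e : 0 <= rho -> 0 < e ->
  exists (C l : R) (E : nat -> set Omega), [/\ 0 < C, 0 <= l, eventually_rare P e E,
    (forall x y, cball xs rho x -> cball xs rho y -> `|F x - F y| <= l * enorm (x - y)) &
    forall n w, (0 < n)%N -> ~ E n w ->
      smooth_on (cball xs rho) C (empirical_risk f (Zs ^~ w) n)].
Proof.
move=> rho0 e0.
have [L [N [mL L0 iL [mN PN] smoothL]]] :=
  random_smoothness d_gt0 Z_meas f_meas A2_C2 alpha_bounds A2_hess A2_grad A2_lip rho0.
have iidL := iid_copies_sample Z_meas Zs_iid mL.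
set l := mean P (L \o Z); have l0 : 0 <= l by apply: mean_ge0 => w; exact: L0.
pose C := l / e + 1; have C0 : 0 < C by rewrite ltr_wpDl// divr_ge0// ltW.
pose Nev := \bigcup_i (Zs i @^-1` N).
have mNi i : measurable (Zs i @^-1` N) by rewrite -[X in measurable X]setTI; exact: mZs.
have mNev : measurable Nev by exact: bigcupT_measurable.
have PNev : P Nev = 0%E.
  apply: measure_negligible => //; apply: negligible_bigcup => i.
  have [_ id _] := Zs_iid; apply/negligibleP => //.
  exact: etrans (id i N mN) PN.
pose E n := Nev `|` [set w | C <= average (fun i => L \o Zs i) n w].
exists C, l, E; split => //.
- have mA n : measurable [set w | C <= average (fun i => L \o Zs i) n w].
    by apply: measurable_ge_set; apply: measurable_average => i; exact: measurableT_comp.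
  split=> [n|]; first exact: measurableU.
  exists 1%N => n n0; rewrite -[e]add0r; apply: probability_union_le => //.
    by rewrite PNev.
  apply: (le_trans (sample_markov iidL iL _ _ C0 n0)) => [w|i w|]; try exact: L0.
  by rewrite lee_fin ler_pdivrMr// /C mulrDr mulrCA divff ?gt_eqF// mulr1 -/l mulr1 lerDl ltW.
- by move=> x y xc yc; apply: (risk_lipschitz Z_meas f_int iL mN PN smoothL).
move=> n w n0 nE.
have sw : smooth_on (cball xs rho) (average (fun i => L \o Zs i) n w)
    (empirical_risk f (Zs ^~ w) n).
  apply: (@smooth_on_avg R d _ n (fun k => f ^~ (Zs k w)) (fun k => L (Zs k w))) => i.
  by apply: smoothL => Nw; apply: nE; left; exists i.
apply: smooth_on_le sw; rewrite leNgt; apply/negP => /ltW h.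
by apply: nE; right.
Qed.

(** Each coordinate is an empirical mean of centered variables with a moment of order
    [1 + alpha]. *)
Lemma empirical_gradient e : 0 < e ->
  exists (A : R) (E : nat -> set Omega), [/\ 0 <= A, eventually_rare P e E &
    forall n w, (0 < n)%N -> ~ E n w ->
      enorm (gradient (empirical_risk f (Zs ^~ w) n) xs) <=
        A * n%:R `^ (- (alpha / (1 + alpha)))].
Proof.
move=> e0; have dR : (0 : R) < d%:R by rewrite ltr0n.
have e'0 : 0 < e / d%:R by rewrite divr_gt0.
pose G i (z : borel T) : R := gradient (f ^~ z) xs ord0 i.
have mG i : measurable_fun setT (G i) := measurable_gradient_coord f_meas A2_C2 xs i.
have iG i : integrableR P (G i \o Z) :=
  gradient_integrable Z_meas f_meas A2_C2 alpha_bounds A2_grad i.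
have iidG i := iid_copies_sample Z_meas Zs_iid (mG i).
have G0 i : mean P (G i \o Z) = 0.
  have [L [N [mL L0 iL [mN PN] smoothL]]] :=
    random_smoothness d_gt0 Z_meas f_meas A2_C2 alpha_bounds A2_hess A2_grad A2_lip ler01.
  exact: (mean_gradient0 Z_meas f_int iL mN PN smoothL ltr01 xs_min (iG i)).
have /choice[A AP] : forall i, exists A, 0 < A /\ forall n, (0 < n)%N ->
    (P [set w | (A * n%:R `^ (- (alpha / (1 + alpha))) <=
       `|average (fun k => G i \o Zs k) n w - mean P (G i \o Z)|)%R] <= (e / d%:R)%:E)%E.
  move=> i; have [A A0 AP] := moment_lln (iidG i) (iG i) alpha_bounds
    (gradient_moment Z_meas f_meas A2_C2 alpha_bounds A2_grad i) e'0.
  by exists A.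
pose q n : R := n%:R `^ (- (alpha / (1 + alpha))).
pose Ei i n := [set w | A i * q n <= `|average (fun k => G i \o Zs k) n w - mean P (G i \o Z)| ].
have rEi i : eventually_rare P (e / d%:R) (Ei i).
  split=> [n|]; first by apply: measurable_deviation => k; exact: measurableT_comp.
  by exists 1%N => n n0; have [_] := AP i; apply.
have rE := eventually_rare_seq (enum 'I_d) rEi.
rewrite size_enum_ord mulrC divfK ?gt_eqF// in rE.
exists (d%:R * \sum_i A i), (fun n => \big[setU/set0]_(i <- enum 'I_d) Ei i n); split => //.
  by rewrite mulr_ge0// sumr_ge0// => i _; have [/ltW] := AP i.
move=> n w n0 nE; rewrite (le_trans (enorm_le_norm _))// -mulrA ler_wpM2l//.
have sA0 : 0 <= \sum_i A i by rewrite sumr_ge0// => i _; have [/ltW] := AP i.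
apply: norm_le_coord => [|i]; first by rewrite mulr_ge0 ?powR_ge0.
rewrite (@gradient_avg R d n (fun k => f ^~ (Zs k w))); last first.
  by move=> k y; case: (A2_C2 (Zs k w)).
have : ~ Ei i n w.
  by move=> h; apply: nE; rewrite -bigcup_seq; exists i => //=; rewrite mem_enum.
move/negP; rewrite -ltNge G0 subr0 => /ltW h; apply: (le_trans h).
rewrite ler_wpM2r ?powR_ge0// (bigD1 i)//= lerDl sumr_ge0// => j _.
by have [/ltW] := AP j.
Qed.

(** The law of large numbers is applied on a net so fine that the Lipschitz constants
    [C] and [l] extend the estimate to the whole ball. *)
Lemma empirical_uniform rho eps C l e : 0 < C -> 0 <= l -> 0 < eps -> 0 < e ->
  (forall x y, cball xs rho x -> cball xs rho y -> `|F x - F y| <= l * enorm (x - y)) ->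
  exists E : nat -> set Omega, eventually_rare P e E /\
    forall n w, ~ E n w -> smooth_on (cball xs rho) C (empirical_risk f (Zs ^~ w) n) ->
      forall x, cball xs rho x -> `|empirical_risk f (Zs ^~ w) n x - F x| <= eps.
Proof.
move=> C0 l0 eps0 e0 lF.
have dR : (0 : R) < d%:R by rewrite ltr0n.
have Cl : 0 < C + l by rewrite ltr_wpDr.
pose delta := eps / 2 / ((C + l) * d%:R).
have delta0 : 0 < delta by rewrite !divr_gt0// mulr_gt0.
have [s [sc net]] := @cball_net R d xs rho delta delta0.
pose Ep p n := [set w | eps / 2 <=
  `|average (fun k => f p \o Zs k) n w - mean P (f p \o Z)| ].
have mp p : measurable_fun [set: borel T] (f p) := measurable_value f_meas p.
have es : 0 < e / (size s).+1%:R by rewrite divr_gt0.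
have rEp p : eventually_rare P (e / (size s).+1%:R) (Ep p).
  apply: weak_lln => //; [exact: iid_copies_sample|exact: f_int|by rewrite divr_gt0].
have [mE [N0 NE]] := eventually_rare_seq s rEp.
exists (fun n => \big[setU/set0]_(p <- s) Ep p n); split.
  split => //; exists N0 => n nN; apply: (le_trans (NE n nN)); rewrite lee_fin.
  by rewrite mulrCA ler_piMr ?(ltW e0)// ler_pdivrMr// mul1r ler_nat.
move=> n w nE sg; apply: (close_from_net sc net sg (ltW Cl) lF).
  rewrite /delta le_eqVlt; apply/orP; left; apply/eqP; field.
  by rewrite !gt_eqF.
move=> p ps; have : ~ Ep p n w by move=> h; apply: nE; rewrite -bigcup_seq; exists p.
by rewrite /F riskE => /negP; rewrite -ltNge => /ltW.
Qed.

(** The constants are chosen in this order: the radius [rho] of a sublevel set of the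
    risk, a bound [C0] on the gradients in that ball, a smoothness constant [C2] on
    the larger ball that the next iterates cannot leave, the strong convexity
    constant [c] there, the scale [h] of the second differences, and the uniform
    distance [eps] between the empirical risk and the risk. *)
Lemma gd_error_rare e : 0 < e ->
  exists (M : R) (E : nat -> set Omega), [/\ 0 <= M, eventually_rare P e E &
    forall (n : nat -> nat) B w, (0 < B)%N -> (0 < n B)%N -> ~ E (n B) w ->
      enorm ((GD f Cgrad Ceval (Zs ^~ w) x0 (n B) B 0 beta).1 - xs) <= M * rate alpha n B].
Proof.
move=> e0; have e4 : 0 < e / 4 by rewrite divr_gt0.
have [rho rho0 level] := sublevel_bounded (F x0 + 1) F_sconvex A1 xs_min.
have [C0 [l0 [E0 [C0p _ rE0 _ smooth0]]]] := empirical_smoothness rho0 e4.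
pose rho2 := rho + C0 + 1.
have rho2p : 0 <= rho2 by rewrite !addr_ge0// ltW.
have [C2 [l2 [E2 [C2p l2p rE2 lF smooth2]]]] := empirical_smoothness rho2p e4.
have [c c0 cF] := A1 (@cball_compact R d xs rho2).
pose h := Num.min 1 (c / (4 * C2)).
have h0 : 0 < h by rewrite lt_min ltr01/= divr_gt0// mulr_gt0.
have h1 : h <= 1 by rewrite ge_min lexx.
have C2h : C2 * h <= c / 4.
  have : h <= c / (4 * C2) by rewrite ge_min lexx orbT.
  by rewrite ler_pdivlMr ?mulr_gt0// ler_pdivlMr//; lra.
pose eps := Num.min 2^-1 (c * h ^+ 2 / 16).
have ch0 : 0 < c * h ^+ 2 by rewrite mulr_gt0// exprn_gt0.
have eps0 : 0 < eps by rewrite lt_min invr_gt0 ltr0n/= divr_gt0.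
have eps1 : eps <= 2^-1 by rewrite ge_min lexx.
have eps2 : 16 * eps <= c * h ^+ 2.
  by rewrite mulrC -ler_pdivlMr// ge_min lexx orbT.
have [E3 [rE3 unif]] := empirical_uniform C2p l2p eps0 e4 lF.
have [A [E4 [A0 rE4 grad]]] := empirical_gradient e4.
have [J betaJ] := exists_small_power C2 beta_bounds.
pose m := Num.min 3^-1 (c / 2 * beta ^+ J).
have m0 : 0 < m.
  have /andP[b0 _] := beta_bounds.
  by rewrite lt_min invr_gt0 ltr0n/= mulr_gt0 ?exprn_gt0 ?divr_gt0.
pose S := C2 * enorm (x0 - xs) * (J.+1 * Ceval + Cgrad)%N%:R / m.
have S0 : 0 <= S by rewrite divr_ge0 ?mulr_ge0 ?enorm_ge0 ?(ltW C2p) ?(ltW m0).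
exists (Num.max 1 (4 * (S + A) / c)), (fun n => (E0 n `|` E2 n) `|` (E3 n `|` E4 n)).
split; first by rewrite le_max ler01.
  have := eventually_rareU (eventually_rareU rE0 rE2) (eventually_rareU rE3 rE4).
  by rewrite (_ : e / 4 + e / 4 + (e / 4 + e / 4) = e); last by lra.
move=> n B w B0 nB0 nE.
have n0 : ~ E0 (n B) w by move=> ?; apply: nE; left; left.
have n2 : ~ E2 (n B) w by move=> ?; apply: nE; left; right.
have n3 : ~ E3 (n B) w by move=> ?; apply: nE; right; left.
have n4 : ~ E4 (n B) w by move=> ?; apply: nE; right; right.
have s0 := smooth0 _ _ nB0 n0; have s2 := smooth2 _ _ nB0 n2.
have close := unif _ _ n3 s2.
have midpoint y z : cball xs rho2 y -> cball xs rho2 z ->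
    F (2^-1 *: (y + z)) <= 2^-1 * F y + 2^-1 * F z - c / 8 * enorm (y - z) ^+ 2.
  move=> yc zc; have half : 0 <= (2^-1 : R) <= 1 by apply/andP; split; lra.
  have := cF _ _ _ half yc zc; rewrite (_ : 1 - 2^-1 = 2^-1 :> R); last by lra.
  by rewrite scalerDr -/F; lra.
have ce0 : (0 < n B * Ceval)%N by rewrite muln_gt0 nB0.
have := good_event_bound rho0 C0p C2p c0 s0 s2 midpoint close level h0 h1 C2h eps2 eps1
  beta_bounds betaJ (n B * Cgrad) ce0 B0.
cbv zeta; rewrite /GD /=; set err := enorm (_ - xs) => bound.
have r0 := rate_gt0 alpha nB0; have err0 : 0 <= err by exact: enorm_ge0.
apply: (quadratic_bound c0 S0 A0 r0 err0); apply: (le_trans bound); apply: lerD.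
  rewrite -/m [leLHS](_ : _ = S * ((n B)%:R / B%:R)); last first.
    rewrite mulnCA -mulnDr natrM /S; field.
    by rewrite !gt_eqF// ltr0n.
  by rewrite ler_wpM2l// ratio_le_rate.
rewrite ler_wpM2r// (le_trans (grad _ _ nB0 n4))// ler_wpM2l//.
by rewrite /rate le_max lexx orbT.
Qed.

End Main.

Theorem theorem1 (R : realType) (d : nat) (d_gt0 : (0 < d)%N)
    (dO : measure_display) (Omega : measurableType dO) (P : probability Omega R)
    (P_complete : measure_is_complete P)
    (T : ptopologicalType) (T_polish : polish R T)
    (Z : Omega -> borel T) (Z_meas : measurable_fun setT Z)
    (Zs : nat -> Omega -> borel T) (Zs_iid : iid_copies P Z Zs)
    (f : 'rV[R]_d -> T -> R)
    (f_meas : measurable_fun setT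
      (fun p : borel 'rV[R]_d * borel T => f p.1 p.2))
    (f_diff : forall (z : T) (x : 'rV[R]_d), differentiable (f ^~ z) x)
    (f_int : forall x : 'rV[R]_d, P.-integrable setT (fun w => (f x (Z w))%:E))
    (F_sconvex : strictly_convex (risk P f Z))
    (xs : 'rV[R]_d) (xs_min : forall x : 'rV[R]_d, risk P f Z xs <= risk P f Z x)
    (A1 : locally_strongly_convex (risk P f Z))
    (alpha : R) (alpha_bounds : 0 < alpha <= 1)
    (A2_C2 : forall z : T, twice_continuously_differentiable (f ^~ z))
    (A2_hess : ('E_P[fun w => opnorm (hessian (f ^~ (Z w)) xs)] < +oo)%E)
    (A2_grad :
      ('E_P[fun w => (enorm (gradient (f ^~ (Z w)) xs) `^ (1 + alpha))%R] < +oo)%E)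
    (A2_lip : forall K : set 'rV[R]_d, compact K ->
      exists M : borel T -> R,
        [/\ measurable_fun setT M,
            forall z, 0 <= M z,
            ('E_P[fun w => M (Z w)] < +oo)%E
          & {ae P, forall w, forall x y : 'rV[R]_d, K x -> K y ->
              opnorm (hessian (f ^~ (Z w)) x - hessian (f ^~ (Z w)) y) <=
                M (Z w) * enorm (x - y)}])
    (Cgrad Ceval : nat) (Cgrad_gt0 : (0 < Cgrad)%N) (Ceval_gt0 : (0 < Ceval)%N)
    (x0 : 'rV[R]_d) (beta : R) (beta_bounds : 0 < beta < 1)
    (n : nat -> nat) (n_gt0 : forall B, (0 < B)%N -> (0 < n B)%N)
    (n_small : ((n B)%:R / B%:R : R) @[B --> \oo] --> (0 : R))
    (n_infty : n @ \oo --> \oo) :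
  bigO_P P
    (fun B w => enorm ((GD f Cgrad Ceval (Zs ^~ w) x0 (n B) B 0 beta).1 - xs))
    (rate alpha n) /\
  (0 < limn_einf (fun B =>
     ((B%:R : R) `^ (alpha / (1 + 3 * alpha)) * rate alpha n B)%R%:E))%E.
Proof.
have mZs i : measurable_fun setT (Zs i) by case: Zs_iid.
split.
- move=> e /andP[e0 e1].
  have [M [E [M0 [mE [N NE]] bound]]] := gd_error_rare d_gt0 Z_meas Zs_iid f_meas f_int
    F_sconvex xs_min A1 alpha_bounds A2_C2 A2_hess A2_grad A2_lip Cgrad Ceval_gt0 x0
    beta_bounds e0.
  exists (M + 1); apply: limn_esup_le_near.
  have nN : \forall B \near \oo, (N <= n B)%N.
    exact: (n_infty _ (nbhs_infty_ge N)).
  near=> B.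
  have B0 : (0 < B)%N by near: B; exact: nbhs_infty_gt.
  have nB0 := n_gt0 B B0.
  have r0 := rate_gt0 alpha nB0.
  apply: (@le_trans _ _ (P (E (n B)))); last by apply: NE; near: B.
  apply: le_measure; rewrite ?inE//.
    apply: measurable_ge_set; apply: measurableT_comp => //; apply: measurable_funM => //.
    by apply: measurable_gd_error => //; rewrite muln_gt0 nB0.
  move=> w /= h; apply: contrapT => nE.
  move: h; rewrite leNgt => /negP; apply.
  rewrite normrM normfV (gtr0_norm r0) ger0_norm ?enorm_ge0// ltr_pdivrMr//.
  by rewrite (le_lt_trans (bound n B w B0 nB0 nE))// ltr_pM2r// ltrDl.
- rewrite /limn_einf lteNr oppe0; apply: (@le_lt_trans _ _ (-1)%:E); last first.
    by rewrite lte_fin ltrN10.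
  apply: limn_esup_le_near; near=> B.
  have B0 : (0 < B)%N by near: B; exact: nbhs_infty_gt.
  by rewrite lee_fin lerN2; apply: rate_lower_bound => //; exact: n_gt0.
Unshelve. all: by end_near. Qed.
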